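(* Let $r>0$, $\sigma>0$. Let $(H_n)_{n\ge0}$ in $\mathcal{C}^1(\mathbb{T}^d\times\mathbb{R}^d,\mathbb{R})$ and $(f_n)_{n\ge0}$ in $\mathcal{C}(\mathbb{T}^d\times\mathcal{P}(\mathbb{T}^d),\mathbb{R})$ be sequences converging locally uniformly, in those spaces, to $H$ and $f$ respectively. Assume that for each $n$, $U_n$ is a monotone solution of the stationary master equation (SME) associated with $H_n$ and $f_n$, and that $(U_n)_{n\ge0}$ converges to some $U\in\mathcal{B}^c$ for the natural topology of $\mathcal{B}$. Then $U$ is a monotone solution of (SME) associated with $H$ and $f$.
   Context: Notation. $d$ is an integer greater than $1$; $\mathbb{T}^d$ is the $d$-dimensional torus; $\mathcal{M}(\mathbb{T}^d)$ is the set of (finite signed) measures; $\mathcal{P}(\mathbb{T}^d)$ is the set of probability measures with the 1-Wasserstein distance (a compact metric space). $\|\cdot\|_2$ is the $\mathcal{C}^2(\mathbb{T}^d)$ norm. $\langle g,\mu\rangle=\int g\,d\mu$, $\langle g,\mathrm{div}(bm)\rangle=-\int\nabla g\cdot b\,dm$, $\langle g,\Delta m\rangle=\int\Delta g\,dm$. $D_pH$ is the gradient of $H$ in its second argument. Convergence in $\mathcal{C}^1(\mathbb{T}^d\times\mathbb{R}^d)$ locally uniformly means local uniform convergence of the functions and their first derivatives. $\mathcal{B}$ is the space of globally continuous $U:\mathbb{T}^d\times\mathcal{P}(\mathbb{T}^d)\to\mathbb{R}$ with $\sup_m\|U(\cdot,m)\|_2<\infty$; its natural topology is that of the norm $\sup_m\|U(\cdot,m)\|_2$.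 $\mathcal{B}^c$ is the subspace of those $U\in\mathcal{B}$ that are continuous seen as maps $\mathcal{P}(\mathbb{T}^d)\to\mathcal{C}^2(\mathbb{T}^d)$. Stationary master equation (SME) associated with $H$ and $f$, on $\mathbb{T}^d\times\mathcal{P}(\mathbb{T}^d)$: $$rU-\sigma\Delta U+H(x,\nabla_xU)-\Big\langle\tfrac{\delta U}{\delta m}(x,m,\cdot),\mathrm{div}\big(D_pH(\cdot,\nabla_xU(\cdot,m))m\big)\Big\rangle-\sigma\Big\langle\tfrac{\delta U}{\delta m}(x,m,\cdot),\Delta m\Big\rangle=f(x,m).$$ Monotone solution of (SME): $U\in\mathcal{B}$ such that for any $\mathcal{C}^2$ function $\phi:\mathbb{T}^d\to\mathbb{R}$, any $\nu\in\mathcal{M}(\mathbb{T}^d)$ and any point $m_0$ of strict minimum of $m\mapsto\langle U(\cdot,m)-\phi,m-\nu\rangle$ on $\mathcal{P}(\mathbb{T}^d)$ (strictly smaller than at any other point), $$r\langle U,m_0-\nu\rangle+\langle-\sigma\Delta U+H(\cdot,\nabla_xU),m_0-\nu\rangle\ge\langle f(\cdot,m_0),m_0-\nu\rangle-\langle U-\phi,\mathrm{div}(D_pH(\cdot,\nabla_xU)m_0)\rangle-\sigma\langle\Delta(U-\phi),m_0\rangle,$$ where $U$ stands for $U(\cdot,m_0)$. *)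

(* Defs.v *)
From HB Require Import structures.
From mathcomp Require Import all_boot all_order all_algebra.
From mathcomp Require Import all_classical all_reals all_analysis.

Set Implicit Arguments.
Unset Strict Implicit.
Unset Printing Implicit Defensive.

Import Order.TTheory GRing.Theory Num.Theory.
Import numFieldNormedType.Exports.

Local Open Scope classical_set_scope.
Local Open Scope ring_scope.
Local Open Scope quotient_scope.

(* The torus is the quotient of R^d by Z^d, with the quotient topology and its
   Borel sigma-algebra. *)
Section Torus.
Variables (R : realType) (d : nat).

Definition torus_rel (x y : 'rV[R]_d) : bool :=
  [forall i, (x 0 i - y 0 i) \is a Num.int].

Lemma torus_rel_refl : reflexive torus_rel.
Proof. by move=> x; apply/forallP => i; rewrite subrr rpred0. Qed.

Lemma torus_rel_sym : symmetric torus_rel.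
Proof.
by move=> x y; apply/forallP/forallP => h i; rewrite -opprB rpredN.
Qed.

Lemma torus_rel_trans : transitive torus_rel.
Proof.
move=> y x z /forallP xy /forallP yz; apply/forallP => i.
by rewrite -(subrKA (y 0 i)) rpredD.
Qed.

Canonical torus_equiv :=
  EquivRel torus_rel torus_rel_refl torus_rel_sym torus_rel_trans.

Definition torus : Type := quotient_topology {eq_quot torus_equiv}.
HB.instance Definition _ := Topological.on torus.
HB.instance Definition _ := Quotient.on torus.
HB.instance Definition _ := Pointed.on torus.
HB.instance Definition _ :=
  Measurable.copy torus (g_sigma_algebraType (@open torus)).

Definition tproj (x : 'rV[R]_d) : torus := \pi_torus x.

End Torus.

Section Calculus.
Variable R : realType.

Definition partial n (i : 'I_n) (h : 'rV[R]_n -> R) : 'rV[R]_n -> R :=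
  fun x => 'D_(delta_mx 0 i) h x.

Definition grad n (h : 'rV[R]_n -> R) (x : 'rV[R]_n) : 'rV[R]_n :=
  \row_i partial i h x.

Fixpoint Ck (k n : nat) (h : 'rV[R]_n -> R) : Prop :=
  continuous h /\
  if k is k'.+1 then
    forall i : 'I_n,
      (forall x, derivable h x (delta_mx 0 i)) /\ Ck k' (partial i h)
  else True.

Definition dotv n (x y : 'rV[R]_n) : R := \sum_i x 0 i * y 0 i.

Definition enorm n (x : 'rV[R]_n) : R := Num.sqrt (dotv x x).

Definition loc_unif_cvg n (h_ : nat -> 'rV[R]_n -> R) (h : 'rV[R]_n -> R) :=
  forall x : 'rV[R]_n, exists2 V, nbhs x V & {uniform V, h_ @ \oo --> h}.

Definition C1_loc_unif_cvg n (h_ : nat -> 'rV[R]_n -> R) (h : 'rV[R]_n -> R) :=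
  loc_unif_cvg h_ h /\
  forall i : 'I_n, loc_unif_cvg (fun k => partial i (h_ k)) (partial i h).

End Calculus.

Section TorusCalculus.
Variables (R : realType) (d : nat).
Local Notation T := (torus R d).
Implicit Types (x y : T) (g : T -> R).

(* Functions on the torus are differentiated through their periodic lifts. *)
Definition tlift g : 'rV[R]_d -> R := fun a => g (tproj a).

Definition tpartial (i : 'I_d) g : T -> R := fun x => partial i (tlift g) (repr x).

Definition tgrad g x : 'rV[R]_d := grad (tlift g) (repr x).

Definition tlaplacian g x : R := \sum_i tpartial i (tpartial i g) x.

Definition tC2 g : Prop := Ck 2 (tlift g).

Definition supnorm g : \bar R := ereal_sup [set `|g x|%:E | x in [set: T]].

Definition c2norm g : \bar R :=
  (supnorm g + \sum_(i < d) supnorm (tpartial i g)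
   + \sum_(i < d) \sum_(j < d) supnorm (tpartial i (tpartial j g)))%E.

Definition tdist x y : R :=
  inf [set enorm (a - b) | a in [set a | tproj a = x]
                         & b in [set b | tproj b = y]].

(* A function on the product of the torus and R^d, lifted to R^(d+d). *)
Definition hlift (H : T -> 'rV[R]_d -> R) : 'rV[R]_(d + d) -> R :=
  fun z => H (tproj (lsubmx z)) (rsubmx z).

Definition gradp (H : T -> 'rV[R]_d -> R) x (p : 'rV[R]_d) : 'rV[R]_d :=
  grad (H x) p.

End TorusCalculus.

Section Measures.
Variables (R : realType) (d : nat).
Local Notation T := (torus R d).
Local Notation P := (probability T R).
Local Notation M := (charge T R).
Implicit Types (g : T -> R) (m : P) (nu : M).

(* A [probability] is a function on all sets, constrained only on measurable
   ones; this is equality as measures. *)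
Definition same_measure m m' : Prop :=
  forall A : set T, measurable A -> m A = m' A.

Definition coupling m m' (gam : probability (T * T)%type R) : Prop :=
  forall A : set T, measurable A ->
    gam (A `*` setT) = m A /\ gam (setT `*` A) = m' A.

Definition W1 m m' : \bar R :=
  ereal_inf [set (\int[gam]_z (tdist z.1 z.2)%:E)%E | gam in coupling m m'].

Definition hahn_pos nu : set T := projT1 (cid (Hahn_decomposition nu)).
Definition hahn_neg nu : set T :=
  projT1 (cid (projT2 (cid (Hahn_decomposition nu)))).
Definition hahnP nu : hahn_decomposition nu (hahn_pos nu) (hahn_neg nu) :=
  projT2 (cid (projT2 (cid (Hahn_decomposition nu)))).

Definition charge_int nu g : R :=
  \int[jordan_pos (hahnP nu)]_x g x - \int[jordan_neg (hahnP nu)]_x g x.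

(* <g, m - nu>, expanded as <g, m> - <g, nu> *)
Definition pair_sub g m nu : R := \int[m]_x g x - charge_int nu g.

(* <g, div (b m)>, defined by duality *)
Definition pair_div g (b : T -> 'rV[R]_d) m : R :=
  - \int[m]_x dotv (tgrad g x) (b x).

(* <g, Delta m> *)
Definition pair_laplacian g m : R := \int[m]_x tlaplacian g x.

End Measures.

Section MonotoneSolution.
Variables (R : realType) (d : nat).
Local Notation T := (torus R d).
Local Notation P := (probability T R).
Local Notation M := (charge T R).
Implicit Types (U f : T -> P -> R) (H : T -> 'rV[R]_d -> R).

Definition continuousTP f : Prop :=
  forall x m (e : R), 0 < e -> exists2 del : R, 0 < del &
    forall y m', tdist x y < del -> (W1 m m' < del%:E)%E ->
      `|f y m' - f x m| < e.

Definition loc_unif_cvgTP (f_ : nat -> T -> P -> R) f : Prop :=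
  forall x m, exists2 del : R, 0 < del &
    forall e : R, 0 < e -> \forall n \near \oo,
      forall y m', tdist x y < del -> (W1 m m' < del%:E)%E ->
        `|f_ n y m' - f y m'| < e.

Definition Bnorm U : \bar R := ereal_sup [set c2norm (U^~ m) | m in [set: P]].

Definition inB U : Prop :=
  [/\ continuousTP U, forall m, tC2 (U^~ m) & (Bnorm U < +oo)%E].

Definition inBc U : Prop :=
  inB U /\
  forall m (e : R), 0 < e -> exists2 del : R, 0 < del &
    forall m', (W1 m m' < del%:E)%E ->
      (c2norm (fun x => U x m' - U x m)%R < e%:E)%E.

Definition Bcvg (U_ : nat -> T -> P -> R) U : Prop :=
  Bnorm (fun x m => U_ n x m - U x m) @[n --> \oo] --> 0%E.

Definition strict_min (F : P -> R) m0 : Prop :=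
  forall m, ~ same_measure m m0 -> F m0 < F m.

(* Monotone solutions of the stationary master equation
     r U - sigma Delta U + H(x, nabla_x U)
       - <dU/dm(x, m, .), div (D_pH(., nabla_x U(., m)) m)>
       - sigma <dU/dm(x, m, .), Delta m> = f(x, m).
   The derivative in the measure does not occur: it is replaced by the
   first-order condition at the minimum points m0. *)
Definition monotone_solution (r sigma : R) H f U : Prop :=
  inB U /\
  forall (phi : T -> R) (nu : M) (m0 : P), tC2 phi ->
    strict_min (fun m => pair_sub (fun x => U x m - phi x) m nu) m0 ->
    let u := U^~ m0 in
    let b := fun x => gradp H x (tgrad u x) in
    let w := fun x => u x - phi x in
    r * pair_sub u m0 nu
    + pair_sub (fun x => - sigma * tlaplacian u x + H x (tgrad u x)) m0 nu
    >= pair_sub (f^~ m0) m0 nu - pair_div w b m0 - sigma * pair_laplacian w m0.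

End MonotoneSolution.

(* Main.v *)
(* The inequality defining monotone solutions passes to the limit at points m_n
   of strict minimum converging to m_0, so the difficulty is to produce such
   points. For each n, a C^2 function psi_n with norm at most 1/(n+1) is found
   such that m |-> <U_n(., m) - (phi - psi_n), m - nu> has a strict minimum, at
   some m_n: this is Stegall's variational principle, for perturbations
   m |-> <psi, m>, psi running over combinations of a countable family that
   separates measures. A cluster point of (m_n) minimizes
   m |-> <U(., m) - phi, m - nu>, hence is m_0 since m_0 is a strict minimum.
   Then one applies the inequality for U_n with the test function phi - psi_n.

   Compactness of the measures on the torus comes from a space-filling curve:
   each measure is the image of Lebesgue measure on [0, 1] under the curve
   composed with a nondecreasing quantile function, Helly's theorem applies to
   the quantile functions, and their pointwise limits provide the couplings that
   bound the Wasserstein distance. *)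

Require Import Defs.
From HB Require Import structures.
From mathcomp Require Import all_boot all_order all_algebra.
From mathcomp Require Import all_classical all_reals all_analysis.
From mathcomp Require Import measurable_realfun ring lra.
Import Order.TTheory GRing.Theory Num.Theory.
Import numFieldNormedType.Exports.
Local Open Scope classical_set_scope.
Local Open Scope ring_scope.
Set Implicit Arguments.
Unset Strict Implicit.
Unset Printing Implicit Defensive.

(** * Perturbations making minimizers unique *)

Section Stegall.
Variables (R : realType) (X : Type).
Implicit Types (J g : X -> R) (a eps eta : R).

(** Monotonicity of a solution says something only at strict minima, and a strict minimum for [U]
    need not persist for [U_n]. A perturbation that creates one has to keep the shape of the
    functional: adding <psi, m> amounts, up to the constant <psi, nu>, to replacing phi by phi -
    psi, so the test function absorbs it. It must be small in C^2, since second derivatives of psi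
    enter the inequality. The nonlinear terms require the gradient and Laplacian of U_n(., m_n) to
    converge uniformly while both the function and the measure move. Convergence in B compares
    U_n(., m_n) with U(., m_n), uniformly in the measure, and membership of U in B^c takes U(., m_n)
    to U(., m_0). Measures are functions on sets, identified only by [same_measure], and compactness
    is used in sequential form. Subsequences are given by maps e with k <= e k, not necessarily
    increasing, which is enough for limits at infinity. *)

Definition near_argmin J a : set X := [set x | forall z, J x <= J z + a].

(* For t < t', approximate minimizers x of J + t g and y of J + t' g satisfy
   g y <= g x up to the error, so oscillations of g at well separated values
   of t add up, and there is room for only finitely many of them. *)
Lemma perturb_small_osc J g eps eta : (forall x, `|g x| <= 1) ->
  0 < eps -> 0 < eta ->
  exists p : R * R, [/\ 0 <= p.1 <= eps, 0 < p.2 &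
    forall x y, near_argmin (fun z => J z + p.1 * g z) p.2 x ->
      near_argmin (fun z => J z + p.1 * g z) p.2 y -> g y - g x <= eta].
Proof.
move=> g1 eps0 eta0; apply: contrapT => /forallNP bad.
(* The upper bound on g will drop by eta / 2 at each of N steps, while g takes values in [-1, 1]: a
   drop N eta / 2 > 2 is impossible. *)
have [N Neta] : exists N : nat, 4 < N%:R * eta.
  exists (Num.trunc (4 / eta)).+1; rewrite -ltr_pdivrMr//.
  exact: truncnS_gt.
have N0 : (0 < N)%N.
  by case: N Neta => //; rewrite mul0r => /lt_trans/(_ (ltr0n R 4)); rewrite ltxx.
have NR0 : 0 < N%:R :> R by rewrite ltr0n.
pose h := eps / N%:R; have h0 : 0 < h by rewrite divr_gt0.
(* Two errors [a] add up to h eta / 2: passing to the next parameter, g can increase by at most eta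
   / 2. *)
pose a := h * eta / 4.
have a0 : 0 < a by rewrite divr_gt0// mulr_gt0.
have badp i : (i <= N)%N -> exists x y,
    [/\ near_argmin (fun z => J z + (i%:R * h) * g z) a x,
        near_argmin (fun z => J z + (i%:R * h) * g z) a y & eta < g y - g x].
  move=> iN; have := bad (i%:R * h, a) => /not_and3P /= [].
  - move=> /negP; rewrite mulr_ge0 ?ler0n ?(ltW h0)//= => /negP; case.
    by rewrite /h mulrCA ger_pMr// ler_pdivrMr// mul1r ler_nat.
  - by rewrite a0.
  - move=> /existsNP[x /existsNP[y /not_implyP[xn /not_implyP[yn]]]].
    by move/negP; rewrite -ltNge => gt; exists x, y.
(* Of two approximate minimizers at step i whose values of g differ by more than eta, the larger
   value obeys the bound, so the smaller one lies eta below it; step i + 1 recovers at most half of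
   that. *)
have bnd i : (i <= N)%N -> forall y,
    near_argmin (fun z => J z + (i%:R * h) * g z) a y ->
    g y <= 1 - i%:R * (eta / 2).
  elim: i => [_ y _|i IH iN y yn].
    by rewrite mul0r subr0; apply: le_trans (g1 y); exact: ler_norm.
  have [x [y' [xn y'n xy']]] := badp _ (ltnW iN).
  have := IH (ltnW iN) _ y'n.
  have := xn y; have := yn x; rewrite -natr1 /a => H1 H2 H3.
  have : h * (g y - g x) <= h * (eta / 2) by lra.
  by rewrite ler_pM2l//; lra.
have [x [y [xn yn _]]] := badp _ (leqnn N).
have := bnd _ (leqnn N) _ yn; have := g1 y; rewrite ler_norml.
by move=> /andP[+ _]; lra.
Qed.

(* The n-th perturbation is along g (logn 2 n.+1), with precision 1/(n+1): every
   direction is thus treated infinitely often. *)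
Lemma perturb_unique_argmin J (g : nat -> X -> R) eps :
  (forall j x, `|g j x| <= 1) -> 0 < eps ->
  exists t : nat -> R, (forall j, `|t j| <= eps / 2 ^+ j) /\
    forall L : X -> R,
      (forall x, J x + \sum_(0 <= j < n) t j * g (logn 2 j.+1) x
        @[n --> \oo] --> L x) ->
      forall x y, near_argmin L 0 x -> near_argmin L 0 y ->
      forall i, g i x = g i y.
Proof.
move=> g1 eps0.
(* [s] holds the current functional, the remaining budget and the index of the step; the guard on
   the budget makes the choice total. *)
have /choice[f fP] : forall s : (X -> R) * R * nat, exists p : R * R,
    0 < s.1.2 -> [/\ 0 <= p.1 <= s.1.2, 0 < p.2 &
    forall x y,
      near_argmin (fun z => s.1.1 z + p.1 * g (logn 2 s.2.+1) z) p.2 x ->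
      near_argmin (fun z => s.1.1 z + p.1 * g (logn 2 s.2.+1) z) p.2 y ->
      g (logn 2 s.2.+1) y - g (logn 2 s.2.+1) x <= s.2.+1%:R^-1].
  move=> [[J' e] j] /=; have [e0|] := ltP 0 e; last by exists 0.
  have j0 : 0 < j.+1%:R^-1 :> R by rewrite invr_gt0.
  have [p pP] := perturb_small_osc J' (g1 (logn 2 j.+1)) e0 j0.
  by exists p.
(* The budget is halved to make the coefficients summable. It is also kept below a_n / 8, so that
   all later perturbations together, at most twice the budget, leave every minimizer of L an
   a_n-approximate minimizer after step n. *)
pose st := fix st n := if n is n'.+1 then
  ((fun x => (st n').1 x + (f (st n', n')).1 * g (logn 2 n'.+1) x),
    Num.min ((st n').2 / 2) ((f (st n', n')).2 / 8)) else (J, eps).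
pose t n := (f (st n, n)).1; pose a n := (f (st n, n)).2.
have st0 n : 0 < (st n).2.
  elim: n => [//|n IH] /=; have [_ an _] := fP (st n, n) IH.
  by rewrite lt_min !divr_gt0.
have tP n : 0 <= t n <= (st n).2 by have [] := fP (st n, n) (st0 n).
have stS n : (st n.+1).2 <= (st n).2 / 2 by rewrite /= ge_min lexx.
have sta n : (st n.+1).2 <= a n / 8 by rewrite /= ge_min lexx orbT.
have stE n x : (st n).1 x = J x + \sum_(0 <= j < n) t j * g (logn 2 j.+1) x.
  elim: n => [|n IH] /=; first by rewrite big_geq// addr0.
  by rewrite big_nat_recr//= addrA -IH.
have st_le n : (st n).2 <= eps / 2 ^+ n.
  elim: n => [|n IH]; first by rewrite expr0 divr1.
  by rewrite (le_trans (stS n))// exprSr invfM mulrA ler_pM2r.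
(* The coefficient t_n is at most the budget, which is at most twice its own drop at step n; the
   drops telescope. *)
have osc n m x : `|(st (n + m)%N).1 x - (st n).1 x| <= 2 * ((st n).2 - (st (n + m)%N).2).
  elim: m => [|m IH]; first by rewrite addn0 !subrr normr0 mulr0.
  rewrite addnS [(st (n + m).+1).1 _]/=.
  have /andP[t0 t1] := tP (n + m)%N; have S2 := stS (n + m)%N.
  have tg : `|t (n + m)%N * g (logn 2 (n + m).+1) x| <= (st (n + m)%N).2.
    by rewrite normrM ger0_norm// -[leRHS]mulr1 ler_pM.
  rewrite addrAC; apply: le_trans (ler_normD _ _) _.
  apply: le_trans (lerD IH tg) _; lra.
exists t; split.
  move=> j; have /andP[t0 t1] := tP j.
  by rewrite ger0_norm// (le_trans t1).
move=> L LP x y xL yL i; apply: contrapT => nxy.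
have Losc n z : `|L z - (st n).1 z| <= 2 * (st n).2.
  have cv : (fun m => `|(st (n + m)%N).1 z - (st n).1 z|) @ \oo --> `|L z - (st n).1 z|.
    apply: cvg_norm; apply: cvgB; last exact: cvg_cst.
    have := LP z; rewrite -(cvg_shiftn n) /=.
    by under [X in _ -> X @ _ --> _]eq_fun do rewrite stE addnC.
  apply: (closed_cvg (fun u : R => u <= 2 * (st n).2)) cv; first exact: closed_le.
  apply: nearW => m; apply: le_trans (osc n m z) _.
  by rewrite ler_pM2l// gerBl ltW.
have slice n z : near_argmin L 0 z -> near_argmin (st n.+1).1 (a n) z.
  move=> zL w; have := zL w; have := Losc n.+1 z; have := Losc n.+1 w.
  have := sta n; have := st0 n.+1; rewrite !ler_norml => H1 H2 /andP[H3 H4] /andP[H5 H6].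
  lra.
wlog lt : x y xL yL nxy / g i x < g i y.
  move=> W; case: (ltgtP (g i x) (g i y)) => [|gt|//]; first exact: W.
  by apply: (W y x) => // e; apply: nxy.
pose N := Num.trunc ((g i y - g i x)^-1).
have gN : (g i y - g i x)^-1 < N.+1%:R by exact: truncnS_gt.
have gap0 : 0 < g i y - g i x by rewrite subr_gt0.
(* j + 1 is 2^i times an odd number, so step j treats direction i, and it exceeds 1 / (g i y - g i
   x), so the precision of that step excludes the gap. *)
pose j := (2 ^ i * N.*2.+1).-1.
have jS : j.+1 = (2 ^ i * N.*2.+1)%N by rewrite /j prednK// muln_gt0 expn_gt0.
have lj : logn 2 j.+1 = i.
  rewrite jS lognM ?expn_gt0// pfactorK// lognE /= dvdn2 /= odd_double /=.
  by rewrite addn0.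
have [_ _ /(_ x y)] := fP (st j, j) (st0 j).
have /= := slice j x xL; have /= := slice j y yL.
rewrite /= lj => yj xj /(_ xj yj).
apply/negP; rewrite -ltNge -[X in _ < X]invrK ltf_pV2 ?posrE ?invr_gt0//.
rewrite (lt_le_trans gN)// ler_nat jS.
rewrite (@leq_trans N.*2.+1)// ?ltnS -?addnn ?leq_addr//.
by rewrite leq_pmull// expn_gt0.
Qed.

End Stegall.

(** * Topology of the torus *)

Section TorusTopology.
Variables (R : realType) (d : nat).
Local Notation T := (torus R d).

Lemma tproj_repr (x : T) : tproj (repr x) = x.
Proof. exact: reprK. Qed.

Lemma tproj_eqP (a b : 'rV[R]_d) : tproj a = tproj b <-> torus_rel a b.
Proof.
have P : reflect (tproj a = tproj b) (torus_rel a b).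
  exact: (@eqmodP _ (torus_equiv R d) a b).
by split => /P.
Qed.

Lemma torus_rel_shift (a b c : 'rV[R]_d) :
  torus_rel a b -> torus_rel (c + a) (c + b).
Proof.
move=> /forallP h; apply/forallP => i; rewrite !mxE opprD addrACA subrr add0r.
exact: h.
Qed.

Lemma tproj_shift (a b c : 'rV[R]_d) :
  tproj a = tproj b -> tproj (c + a) = tproj (c + b).
Proof. by move=> /tproj_eqP h; apply/tproj_eqP; exact: torus_rel_shift. Qed.

Lemma tproj_continuous : continuous (@tproj R d).
Proof. exact: pi_continuous. Qed.

Lemma torus_continuous (Z : topologicalType) (f : T -> Z) :
  continuous (f \o @tproj R d) -> continuous f.
Proof. by move=> h; apply/quotient_continuous. Qed.

(** The projection is open: the preimage of the image of an open set is a union of its integer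
    translates. *)
Lemma nbhs_tproj (a : 'rV[R]_d) (V : set 'rV[R]_d) :
  nbhs a V -> nbhs (tproj a) (@tproj R d @` V).
Proof.
rewrite nbhsE => -[ O [oO Oa] OV]; rewrite nbhsE.
exists (@tproj R d @` O); last by move=> _ [b Ob <-]; exists b => //; exact: OV.
split; last by exists a.
rewrite /open/= /quotient_open/= openE => b [c Oc cb] /=.
have cO : nbhs c O.
  exact: open_nbhs_nbhs.
have : nbhs b (fun b' => O (c - b + b')).
  have h : {for b, continuous (fun b' => c - b + b')}.
    by apply: continuousD; [exact: cst_continuous|exact: cvg_id].
  by apply: h; rewrite /= subrK.
apply: filterS => b' Ob' /=; exists (c - b + b') => //.
have := tproj_shift (b' - b) cb; rewrite subrK => h'; rewrite -[RHS]h'; congr tproj.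
by rewrite addrC addrA addrAC.
Qed.

Lemma torus_compact : compact [set: T].
Proof.
have -> : [set: T] = @tproj R d @` [set v : 'rV[R]_d | forall i, `[0, 1]%classic (v ord0 i)].
  apply/seteqP; split => // x _.
  exists (\row_i (repr x 0 i - (Num.floor (repr x 0 i))%:~R)).
    move=> i /=; rewrite mxE in_itv /= subr_ge0 floor_le.
    by rewrite lerBlDl ltW//; have := floorD1_gt (repr x 0 i); rewrite intrD.
  rewrite -[RHS]tproj_repr; apply/tproj_eqP/forallP => i.
  by rewrite mxE addrAC subrr sub0r rpredN intr_int.
apply: continuous_compact; first exact/continuous_subspaceT/tproj_continuous.
apply: (@rV_compact R d (fun=> `[0, 1]%classic)) => i.
exact: segment_compact.
Qed.

(** A tube argument on the compact torus. It is how local uniform convergence becomes uniform in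
    x. *)
Lemma torus_near (I : Type) (F : set_system I) (P : I -> T -> Prop) :
  Filter F ->
  (forall a : 'rV[R]_d, \forall b \near a & i \near F, P i (tproj b)) ->
  \forall i \near F, forall x, P i x.
Proof.
move=> FF h.
have K : \near F, [set: T] `<=` P F.
  apply: (iffLR (compact_near_coveringP _) torus_compact) => x _.
  rewrite -(tproj_repr x); case: (h (repr x)) => -[V W] /= [Va FW] VW.
  exists (@tproj R d @` V, W); first by split => //; exact: nbhs_tproj.
  by move=> [_ i] /= [[b Vb <-] Wi]; exact: (VW (b, i)).
by apply: filterS K => i Ki x; exact: Ki.
Qed.

(** The lift is invariant under integer translations, so the derivative taken at the chosen
    representative is the derivative at all of them. Iterated derivatives on the torus are thus
    those of the lift. *)
Lemma tlift_partial (i : 'I_d) (g : T -> R) :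
  tlift (tpartial i g) = partial i (tlift g).
Proof.
apply/funext => a; rewrite /tlift /tpartial /partial /derive.
have e : tproj (repr (tproj a)) = tproj a by exact: tproj_repr.
congr (lim _); apply: (congr1 (fun f : R -> R => f @ 0^')).
apply/funext => h /=.
by rewrite /tlift (tproj_shift _ e) e.
Qed.

Lemma tdist_bound (a b : 'rV[R]_d) : tdist (tproj a) (tproj b) <= enorm (a - b).
Proof.
apply: ge_inf; last by exists a => //; exists b.
by exists 0 => _ [u _ [v _ <-]]; exact: sqrtr_ge0.
Qed.

Lemma enorm_continuous : continuous (@enorm R d).
Proof.
have cd : continuous (fun b : 'rV[R]_d => dotv b b).
  apply: (@continuous_big _ _ _ _ _ _ _ _ (fun i (b : 'rV[R]_d) => b 0 i * b 0 i)) => [|i _ b].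
    exact: add_continuous.
  by apply: continuousM; exact: coord_continuous.
move=> a; apply: continuous_comp; [exact: cd|exact: sqrt_continuous].
Qed.

Lemma enorm0 : enorm (0 : 'rV[R]_d) = 0.
Proof.
by rewrite /enorm /dotv big1 ?sqrtr0// => i _; rewrite mxE mul0r.
Qed.

Lemma near_tdist (a : 'rV[R]_d) (e : R) : 0 < e ->
  \forall b \near a, tdist (tproj a) (tproj b) < e.
Proof.
move=> e0.
have c : continuous (fun b : 'rV[R]_d => enorm (a - b)).
  move=> b; apply: continuous_comp; last exact: enorm_continuous.
  by apply: continuousB; [exact: cst_continuous|exact: cvg_id].
have : nbhs (enorm (a - a)) [set x | x < e].
  by rewrite subrr enorm0; apply: open_nbhs_nbhs; split => //; exact: open_lt.
move=> H; have h : \forall b \near a, enorm (a - b) < e := c a _ H.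
by near=> b; apply: le_lt_trans (tdist_bound _ _) _; near: b.
Unshelve. all: end_near.
Qed.



Lemma tdist_refl (x : T) : tdist x x = 0.
Proof.
apply/eqP; rewrite eq_le; apply/andP; split.
  by rewrite -(tproj_repr x); apply: le_trans (tdist_bound _ _) _; rewrite subrr enorm0.
apply: lb_le_inf; last by move=> _ [u _ [v _ <-]]; exact: sqrtr_ge0.
by exists (enorm (repr x - repr x)); exists (repr x) => //=; rewrite ?tproj_repr//;
  exists (repr x) => //=; rewrite tproj_repr.
Qed.

Lemma tlift_continuous (g : T -> R) : continuous (tlift g) <-> continuous g.
Proof.
split; first exact: torus_continuous.
by move=> cg a; apply: continuous_comp; [exact: tproj_continuous|exact: cg].
Qed.

Lemma continuous_torus_measurable (g : T -> R) :
  continuous g -> measurable_fun setT g.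
Proof.
move=> /continuousP cg; apply: (measurability _ (RGenOInfty.measurableE R)).
move=> _ [_ [a ->] <-]; rewrite setTI.
by apply: sub_sigma_algebra; apply: cg; exact: interval_open.
Qed.

Lemma continuous_torus_bounded (g : T -> R) :
  continuous g -> exists2 M : R, 0 < M & forall x, `|g x| <= M.
Proof.
move=> cg; have : compact (g @` [set: T]).
  by apply: continuous_compact torus_compact; exact: continuous_subspaceT.
move=> /compact_bounded[M [_ MP]]; exists (`|M| + 1).
  by rewrite ltr_wpDl.
by move=> x; apply: MP; [rewrite ltr_pwDr// ler_norm|exists x].
Qed.

End TorusTopology.

(** * Functions of class C^k *)

Section CkAlgebra.
Variables (R : realType) (n : nat).
Implicit Types (h : 'rV[R]_n -> R) (F : R -> R) (k : nat).

(** The two difference quotients are the same function, so one-variable rules apply to directional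
    derivatives. *)
Lemma is_derive_line h (x v : 'rV[R]_n) (t df : R) :
  is_derive (t *: v + x) v h df <-> is_derive t 1 (fun s => h (s *: v + x)) df.
Proof.
have e : (fun s : R => s^-1 *: ((h \o shift (t *: v + x)) (s *: v) - h (t *: v + x))) =
    (fun s : R => s^-1 *: (((fun s => h (s *: v + x)) \o shift t) (s *: 1) -
      h (t *: v + x))).
  by apply/funext => s /=; rewrite [s *: 1]mulr1 scalerDl addrA.
by split => -[d1 d2]; split; move: d1 d2; rewrite /derivable /derive e.
Qed.

Lemma is_derive_comp_line F (F' : R) h (x v : 'rV[R]_n) (dh : R) :
  is_derive (h x) 1 F F' -> is_derive x v h dh ->
  is_derive x v (F \o h) (F' * dh).
Proof.
have ex : x = 0 *: v + x by rewrite scale0r add0r.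
move=> dF; rewrite {1 2}ex => /is_derive_line dh0.
apply/is_derive_line.
apply: (@is_derive1_comp _ F (fun s => h (s *: v + x))) => //.
by rewrite -ex.
Qed.

Lemma CkW k h : Ck k.+1 h -> Ck k h.
Proof.
elim: k h => [h [ch _]//|k IH h [ch hh]]; split => // i.
by have [dh /IH ck] := hh i.
Qed.

Lemma Ck_continuous k h : Ck k h -> continuous h.
Proof. by case: k => [|k] []. Qed.

Lemma Ck_is_derive k h i x :
  Ck k.+1 h -> is_derive x (delta_mx 0 i) h (partial i h x).
Proof. by move=> [_ /(_ i)[dh _]]; split => //. Qed.

Lemma CkS k h (dh : 'I_n -> 'rV[R]_n -> R) :
  (forall i x, is_derive x (delta_mx 0 i) h (dh i x)) ->
  continuous h -> (forall i, Ck k (dh i)) -> Ck k.+1 h.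
Proof.
move=> hd ch ck; split => // i; split => [x|].
  by have [] := hd i x.
rewrite (_ : partial i h = dh i)//; apply/funext => x.
by have [_] := hd i x.
Qed.

Lemma partial_val h (i : 'I_n) (x : 'rV[R]_n) (df : R) :
  is_derive x (delta_mx 0 i) h df -> partial i h x = df.
Proof. by case. Qed.

Lemma Ck_cst k (c : R) : Ck k (fun _ : 'rV[R]_n => c).
Proof.
elim: k c => [|k IH] c; first by split => // ; exact: cst_continuous.
apply: (CkS (dh := fun _ _ => 0)) => [|i]; last exact: IH.
exact: cst_continuous.
Qed.

Lemma Ck_add k h1 h2 : Ck k h1 -> Ck k h2 -> Ck k (fun x => h1 x + h2 x).
Proof.
elim: k h1 h2 => [|k IH] h1 h2 H1 H2.
  split => // x; apply: continuousD; [exact: H1.1|exact: H2.1].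
apply: (CkS (dh := fun i x => partial i h1 x + partial i h2 x)) => [i x||i].
- exact: (is_deriveD (Ck_is_derive i x H1) (Ck_is_derive i x H2)).
- move=> x; apply: continuousD; [exact: H1.1|exact: H2.1].
- by apply: IH; [exact: (H1.2 i).2|exact: (H2.2 i).2].
Qed.

Lemma Ck_mul k h1 h2 : Ck k h1 -> Ck k h2 -> Ck k (fun x => h1 x * h2 x).
Proof.
elim: k h1 h2 => [|k IH] h1 h2 H1 H2.
  split => // x; apply: continuousM; [exact: H1.1|exact: H2.1].
apply: (CkS (dh := fun i x => h1 x * partial i h2 x + h2 x * partial i h1 x)) => [i x||i].
- exact: (is_deriveM (Ck_is_derive i x H1) (Ck_is_derive i x H2)).
- move=> x; apply: continuousM; [exact: H1.1|exact: H2.1].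
- apply: Ck_add; apply: IH.
  + exact: CkW H1.
  + exact: (H2.2 i).2.
  + exact: CkW H2.
  + exact: (H1.2 i).2.
Qed.

Lemma Ck_scale k (c : R) h : Ck k h -> Ck k (fun x => c * h x).
Proof. by apply: Ck_mul; exact: Ck_cst. Qed.

Lemma Ck_sub k h1 h2 : Ck k h1 -> Ck k h2 -> Ck k (fun x => h1 x - h2 x).
Proof.
move=> H1 H2; under eq_fun do rewrite -mulN1r.
by apply: Ck_add => //; exact: Ck_scale.
Qed.

Lemma Ck_sum k (I : Type) (s : seq I) (h_ : I -> 'rV[R]_n -> R) :
  (forall i, Ck k (h_ i)) -> Ck k (fun x => \sum_(i <- s) h_ i x).
Proof.
move=> H; elim: s => [|i s IH].
  by under eq_fun do rewrite big_nil; exact: Ck_cst.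
by under eq_fun do rewrite big_cons; exact: Ck_add.
Qed.

Lemma Ck_prod k (I : Type) (s : seq I) (h_ : I -> 'rV[R]_n -> R) :
  (forall i, Ck k (h_ i)) -> Ck k (fun x => \prod_(i <- s) h_ i x).
Proof.
move=> H; elim: s => [|i s IH].
  by under eq_fun do rewrite big_nil; exact: Ck_cst.
by under eq_fun do rewrite big_cons; exact: Ck_mul.
Qed.

Lemma Ck_coord k (j : 'I_n) : Ck k (fun x : 'rV[R]_n => x 0 j).
Proof.
case: k => [|k]; first by split => //; exact: coord_continuous.
apply: (CkS (dh := fun i _ => (delta_mx 0 i : 'rV[R]_n) 0 j)) => [i x||i].
- have ex : x = 0 *: delta_mx 0 i + x by rewrite scale0r add0r.
  rewrite [X in is_derive X]ex; apply/is_derive_line.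
  under eq_fun do rewrite mxE mxE.
  apply: is_derive_eq; rewrite addr0.
  by rewrite [_ *: _]mulr0 add0r [_ *: _]mulr1.
- exact: coord_continuous.
- exact: Ck_cst.
Qed.

(** The one-variable counterpart of [Ck], for the outer functions of compositions. *)
Fixpoint smooth1 k F : Prop :=
  continuous F /\ if k is k'.+1 then
    exists F', (forall x, is_derive x (1 : R) F (F' x)) /\ smooth1 k' F'
  else True.

Lemma Ck_comp k F h : smooth1 k F -> Ck k h -> Ck k (F \o h).
Proof.
elim: k F h => [|k IH] F h.
  by move=> [cF _] [ch _]; split => // x; apply: continuous_comp; [exact: ch|exact: cF].
move=> sF ckh; have [cF [F' [dF sF']]] := sF.
apply: (CkS (dh := fun i x => (F' \o h) x * partial i h x)) => [i x||i].
- exact: (is_derive_comp_line (dF (h x)) (Ck_is_derive i x ckh)).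
- by move=> x; apply: continuous_comp; [exact: ckh.1|exact: cF].
- by apply: Ck_mul; [apply: IH => //; exact: CkW|exact: (ckh.2 i).2].
Qed.

Lemma smooth1_scale k (c : R) F : smooth1 k F -> smooth1 k (fun x => c * F x).
Proof.
elim: k F => [|k IH] F.
  by move=> [cF _]; split => // x; apply: continuousM; [exact: cst_continuous|exact: cF].
move=> [cF [F' [dF sF]]]; split.
  by move=> x; apply: continuousM; [exact: cst_continuous|exact: cF].
exists (fun x => c * F' x); split; last exact: IH.
by move=> x; have := dF x; exact: is_deriveZ.
Qed.

Lemma smooth1_cos k (c : R) :
  smooth1 k (fun x => c * cos x) /\ smooth1 k (fun x => c * sin x).
Proof.
elim: k c => [|k IH] c; split; (split => [x|]; last first) => //.
- by apply: continuousM; [exact: cst_continuous|exact: continuous_cos].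
- by apply: continuousM; [exact: cst_continuous|exact: continuous_sin].
- exists (fun x => (- c) * sin x); split; last exact: (IH (- c)).2.
  by move=> x; rewrite mulNr -mulrN; exact: is_deriveZ.
- by apply: continuousM; [exact: cst_continuous|exact: continuous_cos].
- exists (fun x => c * cos x); split; last exact: (IH c).1.
  by move=> x; exact: is_deriveZ.
- by apply: continuousM; [exact: cst_continuous|exact: continuous_sin].
Qed.

Lemma continuous_pospow m : continuous (fun s : R => Num.max 0 s ^+ m.+1).
Proof.
move=> x; apply: (@continuous_comp _ _ _ (fun s : R => Num.max 0 s) (fun s => s ^+ m.+1)).
  by apply: continuous_max; [exact: cst_continuous|exact: cvg_id].
exact: exprn_continuous.
Qed.

(** Only 0 needs an argument: there the difference quotient is 0 on the left and t^(m+1) on the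
    right. The cube of the positive part is therefore C^2, as the test functions require. *)
Lemma is_derive_pospow m (s : R) :
  is_derive s (1 : R) (fun s => Num.max 0 s ^+ m.+2) (m.+2%:R * Num.max 0 s ^+ m.+1).
Proof.
have [s0|s0|->] := ltgtP s 0.
- rewrite expr0n /= mulr0.
  apply: (near_eq_is_derive (f := cst 0)).
    near=> t; rewrite max_l ?expr0n//=; apply/ltW; near: t.
    exact: lt_nbhsl.
- apply: (near_eq_is_derive (f := fun t : R => t ^+ m.+2)).
    near=> t; rewrite max_r//; apply/ltW; near: t.
    exact: lt_nbhsr.
  by have := @is_deriveX R R id m.+2 s 1 1 (is_derive_id _ _); rewrite [_ *: _]mulr1 exprfctE.
- rewrite expr0n /= mulr0.
  have cv : (fun t : R => t^-1 *: (((fun s : R => Num.max 0 s ^+ m.+2) \o shift (0 : R))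
      (t *: (1 : R)) - Num.max 0 (0 : R) ^+ m.+2)) @ 0^' --> (0 : R).
    apply: (@cvg_trans _ ((fun t : R => t^-1 * Num.max 0 t ^+ m.+2) @ 0^')).
      apply: near_eq_cvg; near=> t => /=.
      by rewrite addr0 maxxx expr0n subr0 [t *: 1]mulr1.
    apply/cvgrPdist_lt => e e0.
    have := @continuous_pospow m 0 => /cvgrPdist_lt /(_ e e0) c0.
    have {}c0 : \forall t \near 0^', `|Num.max 0 0 ^+ m.+1 - Num.max 0 t ^+ m.+1| < e.
      exact: nbhs_dnbhs.
    near=> t; rewrite sub0r normrN.
    have t0 : t != 0 by near: t; exact: nbhs_dnbhs_neq.
    apply: (@le_lt_trans _ _ `|Num.max 0 0 ^+ m.+1 - Num.max 0 t ^+ m.+1|); last by near: t.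
    rewrite maxxx expr0n /= sub0r normrN; have [tn|tp] := leP t 0.
      by rewrite expr0n mulr0 normr0.
    by rewrite exprS mulrA mulVf ?mul1r.
  split; first by apply/cvg_ex; exists 0.
  exact: cvg_lim cv.
Unshelve. all: end_near. Qed.

Lemma smooth1_pospow : smooth1 2 (fun s : R => Num.max 0 s ^+ 3).
Proof.
split; first exact: continuous_pospow.
exists (fun s : R => 3 * Num.max 0 s ^+ 2); split => [x|].
  exact: is_derive_pospow.
apply: smooth1_scale; split; first exact: continuous_pospow.
exists (fun s : R => 2 * Num.max 0 s ^+ 1); split => [x|].
  exact: is_derive_pospow.
by apply: smooth1_scale; split => //; exact: continuous_pospow.
Qed.

End CkAlgebra.

(** * Termwise differentiation of geometrically dominated series *)

Section CkSeries.
Variables (R : realType).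

Lemma cvg_geometric_bound (u : R^nat) (C : R) :
  (forall j, `|u j| <= C / 2 ^+ j) ->
  cvgn (series u) /\
  forall N, `|limn (series u) - series u N| <= 2 * C / 2 ^+ N.
Proof.
move=> uC; have C0 : 0 <= C.
  by have := uC 0; rewrite expr0 divr1; apply: le_trans.
(* The subtracted term makes the induction go through; dropping it afterwards gives the bound on the
   tail. *)
have tail N m : `|series u (N + m)%N - series u N| <= 2 * C / 2 ^+ N - 2 * C / 2 ^+ (N + m).
  elim: m => [|m IH]; first by rewrite addn0 !subrr normr0.
  rewrite addnS seriesSr addrAC; apply: le_trans (ler_normD _ _) _.
  apply: le_trans (lerD IH (uC _)) _.
  have : 2 ^+ (N + m).+1 != 0 :> R by rewrite expf_neq0.
  rewrite exprS => h; have h2 : 2 ^+ (N + m) != 0 :> R by rewrite expf_neq0.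
  have -> : 2 * C / (2 * 2 ^+ (N + m)) = C / 2 ^+ (N + m) by field.
  lra.
have tail' N m : `|series u (N + m)%N - series u N| <= 2 * C / 2 ^+ N.
  apply: le_trans (tail N m) _; rewrite gerBl divr_ge0 ?mulr_ge0// exprn_ge0//.
have cv : cvgn (series u).
  apply: normed_cvg; apply: (@series_le_cvg _ _ (geometric C 2^-1)).
  - by move=> j /=.
  - by move=> j; rewrite /= mulr_ge0// exprn_ge0// invr_ge0.
  - by move=> j; rewrite /= exprVn.
  - apply: is_cvg_geometric_series.
    by rewrite ger0_norm ?invr_ge0// invf_lt1// ltr1n.
split => // N.
have c2 : (fun m => `|series u (N + m)%N - series u N|) @ \oo --> `|limn (series u) - series u N|.
  apply: cvg_norm; apply: cvgB; last exact: cvg_cst.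
  by have := cv; rewrite -(cvg_shiftn N) /=; under eq_cvg do rewrite addnC.
apply: (closed_cvg (fun v : R => v <= 2 * C / 2 ^+ N)) c2; first exact: closed_le.
exact: nearW (tail' N).
Qed.

Lemma geometric_small (C e : R) : 0 < e -> exists N, C / 2 ^+ N < e.
Proof.
move=> e0; have : (fun N => C / 2 ^+ N) @ \oo --> (0 : R).
  have := @cvg_geometric R C 2^-1; rewrite ger0_norm ?invr_ge0//.
  rewrite invf_lt1// ltr1n => /(_ isT).
  by apply: cvg_trans; apply: near_eq_cvg; apply: nearW => N; rewrite /= exprVn.
move=> /cvgrPdist_lt/(_ _ e0)[N _ /(_ N (leqnn N))]; rewrite sub0r normrN => h.
by exists N; exact: le_lt_trans (ler_norm _) h.
Qed.

Definition fun_series (X : Type) (h_ : nat -> X -> R) : X -> R :=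
  fun x => limn (series (fun j => h_ j x)).

Lemma fun_series_continuous (X : topologicalType) (g_ : nat -> X -> R) (C : R) :
  (forall j, continuous (g_ j)) -> (forall j x, `|g_ j x| <= C / 2 ^+ j) ->
  continuous (fun_series g_) /\ (forall x, `|fun_series g_ x| <= 2 * C).
Proof.
move=> cg gC; have B x := cvg_geometric_bound (fun j => gC j x).
split; last first.
  move=> x; have := (B x).2 0; rewrite /series /= big_geq// subr0.
  by rewrite expr0 divr1.
move=> x; apply/(@cvgrPdist_lt _ _ _ (nbhs x) (nbhs_filter x)) => e e0.
have e3 : 0 < e / 3 by rewrite divr_gt0.
have [N Ne] := @geometric_small (2 * C) _ e3.
have cS : continuous (fun y => series (g_ ^~ y) N).
  rewrite /series /=; apply: (@continuous_big _ _ _ _ _ _ _ _ (fun j y => g_ j y)).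
    exact: add_continuous.
  by move=> j _; exact: cg.
have := cS x => /cvgrPdist_lt/(_ _ e3) near_N.
near=> y.
have T1 := (B x).2 N; have T2 := (B y).2 N.
have T3 : `|series (g_ ^~ x) N - series (g_ ^~ y) N| < e / 3 by near: y.
move: T1 T2 T3; rewrite /fun_series.
set a := limn _; set b := series _ N; set c := limn _; set b' := series _ N => T1 T2 T3.
have -> : a - c = (a - b) + (b - b') - (c - b') by ring.
apply: le_lt_trans (ler_normB _ _) _.
apply: le_lt_trans (lerD (ler_normD _ _) (lexx _)) _.
lra.
Unshelve. all: end_near. Qed.

Lemma lipschitz_of_derive (h h' : R -> R) (M : R) :
  (forall x, is_derive x (1 : R) h (h' x)) -> (forall x, `|h' x| <= M) ->
  forall x y, `|h y - h x| <= M * `|y - x|.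
Proof.
move=> dh hM; suff H x y : x <= y -> `|h y - h x| <= M * `|y - x|.
  move=> x y; have [/H//|/ltW/H] := leP x y.
  by rewrite distrC (distrC x).
move=> xy; have [|c _ ->] := @MVT_segment R h h' x y xy.
- apply: continuous_subspaceT => z.
  by apply/differentiable_continuous/derivable1_diffP; case: (dh z).
- by rewrite normrM ler_wpM2r.
Qed.

(** By the mean value theorem the tail after N terms is Lipschitz with constant 2 C / 2^N, so its
    difference quotients are small uniformly in the increment, and only a finite sum remains to be
    differentiated. *)
Lemma is_derive_series (h_ h'_ : nat -> R -> R) (C : R) :
  (forall j x, is_derive x (1 : R) (h_ j) (h'_ j x)) ->
  (forall j x, `|h_ j x| <= C / 2 ^+ j) ->
  (forall j x, `|h'_ j x| <= C / 2 ^+ j) ->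
  forall x, is_derive x (1 : R) (fun_series h_) (fun_series h'_ x).
Proof.
move=> dh hC h'C x.
have S_cv y := (cvg_geometric_bound (fun j => hC j y)).1.
have S'_cv := (cvg_geometric_bound (fun j => h'C j x)).
have C0 : 0 <= C.
  by have := hC 0 0; rewrite expr0 divr1; apply: le_trans.
have tail N t : `|(fun_series h_ (t + x) - fun_series h_ x) -
    (series (h_ ^~ (t + x)) N - series (h_ ^~ x) N)| <= 2 * C / 2 ^+ N * `|t|.
  have bj j : `|h_ j (t + x) - h_ j x| <= C * `|t| / 2 ^+ j.
    have := lipschitz_of_derive (dh j) (h'C j) x (t + x).
    by rewrite addrK mulrAC.
  have [_ /(_ N)] := cvg_geometric_bound bj.
  have -> : series (fun j => h_ j (t + x) - h_ j x) =
      (fun N => series (h_ ^~ (t + x)) N - series (h_ ^~ x) N).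
    by apply/funext => m; rewrite /series /= -sumrB.
  rewrite (cvg_lim _ (cvgB (S_cv _) (S_cv _)))//.
  by rewrite (_ : 2 * (C * `|t|) / 2 ^+ N = 2 * C / 2 ^+ N * `|t|)//; ring.
have dS N : is_derive x (1 : R) (fun y => series (h_ ^~ y) N) (series (h'_ ^~ x) N).
  have -> : (fun y => series (h_ ^~ y) N) = \sum_(j < N) h_ j.
    by apply/funext => y; rewrite /series /= big_mkord fct_sumE.
  have -> : series (h'_ ^~ x) N = \sum_(j < N) h'_ j x by rewrite /series /= big_mkord.
  exact: (is_derive_sum (fun j => dh j x)).
have cv : (fun t : R => t^-1 *: (((fun_series h_) \o shift x) (t *: 1) -
     fun_series h_ x)) @ 0^' --> fun_series h'_ x.
  apply/cvgrPdist_lt => e e0.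
  have [N Ne] := @geometric_small (2 * C) (e / 3) (divr_gt0 e0 (ltr0n _ 3)).
  have : (fun t : R => t^-1 *: (((fun y => series (h_ ^~ y) N) \o shift x) (t *: 1) -
     series (h_ ^~ x) N)) @ 0^' --> series (h'_ ^~ x) N.
    by case: (dS N) => d1 <-; exact: d1.
  move=> /cvgrPdist_lt/(_ _ (divr_gt0 e0 (ltr0n _ 3))) near_N.
  near=> t.
  have t0 : t != 0 by near: t; exact: nbhs_dnbhs_neq.
  have T1 : `|series (h'_ ^~ x) N - t^-1 * (series (h_ ^~ (t + x)) N - series (h_ ^~ x) N)| < e / 3.
    suff: `|series (h'_ ^~ x) N - t^-1 *: (((fun y => series (h_ ^~ y) N) \o shift x) (t *: 1) -
     series (h_ ^~ x) N)| < e / 3 by rewrite /= [t *: 1]mulr1.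
    by near: t.
  have T2 := S'_cv.2 N.
  have T3 : `|t^-1 * (fun_series h_ (t + x) - fun_series h_ x) -
      t^-1 * (series (h_ ^~ (t + x)) N - series (h_ ^~ x) N)| <= 2 * C / 2 ^+ N.
    rewrite -mulrBr normrM normfV [leLHS]mulrC ler_pdivrMr ?normr_gt0//.
  rewrite /= [t *: 1]mulr1 [_ *: _]/(_ * _).
  move: T1 T2 T3; rewrite /fun_series.
  set a := limn _; set b := series _ N; set c := t^-1 * _; set c' := t^-1 * _ => T1 T2 T3.
  have -> : a - c' = (a - b) + (b - c) - (c' - c) by ring.
  apply: le_lt_trans (ler_normB _ _) _.
  apply: le_lt_trans (lerD (ler_normD _ _) (lexx _)) _.
  lra.
split; first by apply/cvg_ex; exists (fun_series h'_ x).
exact: cvg_lim cv.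
Unshelve. all: end_near. Qed.

Variable n : nat.

(** One real bound for all the partial derivatives of order at most k, each taken separately,
    whereas [c2norm] adds their suprema in the extended reals. *)
Fixpoint Ck_bound k (h : 'rV[R]_n -> R) (M : R) : Prop :=
  (forall x, `|h x| <= M) /\
  if k is k'.+1 then forall i, Ck_bound k' (partial i h) M else True.

Lemma Ck_series k (h_ : nat -> 'rV[R]_n -> R) (C : R) :
  (forall j, Ck k (h_ j)) -> (forall j, Ck_bound k (h_ j) (C / 2 ^+ j)) ->
  Ck k (fun_series h_) /\ Ck_bound k (fun_series h_) (2 * C).
Proof.
have base := @fun_series_continuous 'rV[R]_n.
elim: k h_ => [|k IH] h_ H B.
  have [||c b] := base h_ C; [by move=> j; exact: (H j).1|by move=> j; exact: (B j).1|].
  by split.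
have [||c b] := base h_ C; [by move=> j; exact: (H j).1|by move=> j; exact: (B j).1|].
have dS i x : is_derive x (delta_mx 0 i) (fun_series h_)
    (fun_series (fun j => partial i (h_ j)) x).
  have ex : x = 0 *: delta_mx 0 i + x by rewrite scale0r add0r.
  suff D : is_derive (0 *: delta_mx 0 i + x) (delta_mx 0 i) (fun_series h_)
    (fun_series (fun j => partial i (h_ j)) (0 *: delta_mx 0 i + x)) by rewrite -ex in D.
  apply/is_derive_line.
  apply: (@is_derive_series (fun j s => h_ j (s *: delta_mx 0 i + x))
     (fun j s => partial i (h_ j) (s *: delta_mx 0 i + x)) C).
  - by move=> j s; apply/is_derive_line; exact: Ck_is_derive (H j).
  - by move=> j s; exact: (B j).1.
  - by move=> j s; case: k IH H B => [|k] IH H B; exact: ((B j).2 i).1.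
have I i := IH (fun j => partial i (h_ j)) (fun j => ((H j).2 i).2) (fun j => (B j).2 i).
have pE i : partial i (fun_series h_) = fun_series (fun j => partial i (h_ j)).
  by apply/funext => x; exact: partial_val (dS i x).
split; last by split => // i; rewrite pE; exact: (I i).2.
by apply: CkS (dS) c _ => i; exact: (I i).1.
Qed.

End CkSeries.

(** * The space-filling curve and quantiles *)

Section CosineGap.
Variable R : realType.
Local Notation pi := (@pi R).

Lemma cos2pi_int (s : R) (m : int) : cos (2 * pi * (s + m%:~R)) = cos (2 * pi * s).
Proof.
have H (k : nat) t : cos (2 * pi * (t + k%:R)) = cos (2 * pi * t).
  rewrite -[RHS](periodicn (@cosD2pi R) k); congr cos.
  by rewrite -[_ *+ k]mulr_natr; ring.
case: m => k; first exact: H.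
by have := H k.+1 (s - k.+1%:R); rewrite subrK => ->; rewrite NegzE mulrNz.
Qed.

Lemma int_dist_half (s : R) : exists m : int, `|s - m%:~R| <= 2^-1.
Proof.
exists (Num.floor (s + 2^-1)).
have := floor_le (s + 2^-1); have := floorD1_gt (s + 2^-1).
rewrite intrD; set f := _%:~R => h1 h2.
by rewrite ler_norml; lra.
Qed.

Lemma cos_int_dist (s : R) (m : int) :
  cos (2 * pi * s) = cos (2 * pi * `|s - m%:~R|).
Proof.
rewrite -(cos2pi_int s (- m)) mulrNz.
by case: (ger0P (s - m%:~R)) => // _; rewrite mulrN cosN.
Qed.

(** Replace s by its distance to a nearest integer: this lies in [0, 1/2], where s |-> cos (2 pi s)
    is decreasing. *)
Lemma cos_gap_near_int (s eta : R) : 0 < eta -> eta <= 2^-1 ->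
  1 - cos (2 * pi * s) < 1 - cos (2 * pi * eta) -> exists m : int, `|s - m%:~R| < eta.
Proof.
move=> eta0 eta1; have [m mh] := int_dist_half s.
rewrite (cos_int_dist s m) ltrD2l ltrN2.
have p0 := pi_gt0 R.
have i01 (t : R) : 0 <= t -> t <= 2^-1 -> 2 * pi * t \in `[0, pi].
  move=> t0 t1; rewrite in_itv /= !mulr_ge0 ?(ltW p0)//=.
  have : pi * t <= pi * 2^-1 by rewrite ler_pM2l.
  lra.
rewrite ltr_cos ?i01// ?(ltW eta0)//.
by rewrite ltr_pM2l ?mulr_gt0// => h; exists m.
Qed.

Variable d : nat.
Local Notation T := (torus R d).

(** A smooth periodic substitute for the squared distance to a: it vanishes only at the class of a,
    and small values force closeness. *)
Definition torus_gap (a : 'rV[R]_d) (x : T) : R :=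
  \sum_i (1 - cos (2 * pi * (repr x 0 i - a 0 i))).

Lemma tlift_gap a b : tlift (torus_gap a) b = \sum_i (1 - cos (2 * pi * (b 0 i - a 0 i))).
Proof.
apply: eq_bigr => i _; congr (1 - _).
have /tproj_eqP/forallP/(_ i) := tproj_repr (tproj b).
move=> /intrP[m mE].
have -> : repr (tproj b) 0 i = b 0 i + m%:~R by rewrite -mE addrC subrK.
by rewrite addrAC cos2pi_int.
Qed.

Lemma gap_ge0 (s : R) : 0 <= 1 - cos s.
Proof. by rewrite subr_ge0 cos_le1. Qed.

Lemma torus_gap_ge0 a x : 0 <= torus_gap a x.
Proof. by apply: sumr_ge0 => i _; exact: gap_ge0. Qed.

Lemma torus_gap_lt (a b : 'rV[R]_d) (eta : R) : 0 < eta -> eta <= 2^-1 ->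
  torus_gap a (tproj b) < 1 - cos (2 * pi * eta) ->
  exists c, tproj c = tproj b /\ forall i, `|c 0 i - a 0 i| < eta.
Proof.
move=> eta0 eta1; rewrite [torus_gap _ _](tlift_gap a b) => h.
have H i : exists m : int, `|(b 0 i - a 0 i) - m%:~R| < eta.
  apply: cos_gap_near_int => //; apply: le_lt_trans h.
  by rewrite (bigD1 i)//= lerDl; apply: sumr_ge0 => j _; exact: gap_ge0.
have [m mP] := choice H.
exists (\row_i (b 0 i - (m i)%:~R)); split.
  by apply/tproj_eqP/forallP => i; rewrite mxE addrAC subrr sub0r rpredN intr_int.
by move=> i; rewrite mxE addrAC.
Qed.

Lemma Ck_gap k a : Ck k (tlift (torus_gap a)).
Proof.
rewrite (funext (tlift_gap a)); apply: Ck_sum => i.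
apply: Ck_sub; first exact: Ck_cst.
apply: (@Ck_comp _ _ _ cos (fun b => 2 * pi * (b 0 i - a 0 i))).
  by have := (@smooth1_cos R k 1).1; under eq_fun do rewrite mul1r.
by apply: Ck_scale; apply: Ck_sub; [exact: Ck_coord|exact: Ck_cst].
Qed.

Lemma torus_gap_continuous a : continuous (torus_gap a).
Proof. exact/tlift_continuous/Ck_continuous/(Ck_gap 0). Qed.

Lemma torus_gap_eq0 a x : torus_gap a x = 0 -> tproj a = x.
Proof.
rewrite -(tproj_repr x) => h0; apply/tproj_eqP/forallP => i.
have : 1 - cos (2 * pi * (repr x 0 i - a 0 i)) = 0.
  move/eqP: h0; rewrite [torus_gap _ _](tlift_gap a (repr x)) psumr_eq0.
    by move=> /allP/(_ i); rewrite mem_index_enum => /(_ isT)/eqP.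
  by move=> j _; exact: gap_ge0.
have [m mh] := int_dist_half (repr x 0 i - a 0 i).
rewrite (cos_int_dist _ m); set r := `|_| in mh *; have p0 := pi_gt0 R.
have [r0|r0 /eqP] := leP r 0.
  move=> _; have /eqP : r = 0 by apply/eqP; rewrite eq_le r0 normr_ge0.
  by rewrite normr_eq0 subr_eq0 => /eqP e; rewrite -opprB rpredN e intr_int.
suff : cos (2 * pi * r) < cos 0 by rewrite cos0 => h /eqP; lra.
have : pi * r <= pi * 2^-1 by rewrite ler_pM2l.
have : 0 < pi * r by rewrite mulr_gt0.
by move=> h1 h2; rewrite ltr_cos ?in_itv/= ?lexx; lra.
Qed.

(** The gap to a representative of x vanishes at x only; if it is positive at y, its sublevel and
    superlevel sets at half that value separate the points. *)
Lemma torus_hausdorff : hausdorff_space T.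
Proof.
move=> x y xy; rewrite -(tproj_repr x); apply: torus_gap_eq0.
apply/eqP; apply: contrapT => /negP; rewrite neq_lt ltNge torus_gap_ge0 /= => g0.
set g := torus_gap _ in g0.
have gx : g x = 0.
  have := tlift_gap (repr x) (repr x); rewrite /g /tlift tproj_repr => ->.
  by apply: big1 => i _; rewrite subrr mulr0 cos0 subrr.
have cg : continuous g := @torus_gap_continuous (repr x).
have nx : nbhs x [set z | g z < g y / 2].
  by apply: (cg x [set s | s < g y / 2]); apply: open_nbhs_nbhs; split;
    [exact: open_lt|rewrite /= gx divr_gt0].
have ny : nbhs y [set z | g y / 2 < g z].
  apply: (cg y [set s | g y / 2 < s]); apply: open_nbhs_nbhs; split.
    exact: open_gt.
  by rewrite /=; lra.
have [z [/= z1 z2]] := xy _ _ nx ny.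
by have := lt_trans z1 z2; rewrite ltxx.
Qed.

End CosineGap.

Lemma increasing_seq_ge (f : nat -> nat) : increasing_seq f -> forall n, (n <= f n)%N.
Proof.
move=> fi; elim=> // n IH; apply: leq_ltn_trans IH _.
by have := fi n.+1 n; rewrite !leEnat ltnn leqNgt => /negbFE.
Qed.

(** * Schoenberg's curve and its surjectivity *)

Section Curve.
Variable R : realType.
Local Notation pi := (@pi R).

(* Schoenberg's space-filling curve: [sch (3 ^+ k * t)] is the k-th digit of t
   in base 3 when all the digits are 0 or 1. *)
Definition sch (s : R) : R :=
  Num.max 0 (Num.min 1 (1 - (cos (pi / 3))^-1 * cos (2 * pi * s))).

Lemma sch_continuous : continuous sch.
Proof.
have c : continuous (fun s => cos (2 * pi * s)).
  move=> s; apply: continuous_comp; last exact: continuous_cos.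
  by apply: continuousM; [exact: cst_continuous|exact: cvg_id].
move=> s; suff : {for s, continuous ((cst 0 : R -> R^o) \max ((cst 1 : R -> R^o) \min
  (fun s => 1 - (cos (pi / 3))^-1 * cos (2 * pi * s) : R^o)))} by [].
apply: continuous_max; first exact: cst_continuous.
apply: continuous_min; first exact: cst_continuous.
apply: continuousB; first exact: cst_continuous.
by apply: continuousM; [exact: cst_continuous|exact: c].
Qed.

Lemma sch01 s : 0 <= sch s <= 1.
Proof. by rewrite /sch le_max lexx /= ge_max ler01 ge_min lexx. Qed.

Lemma schD (s : R) (k : nat) : sch (s + k%:R) = sch s.
Proof. by rewrite /sch (cos2pi_int s k). Qed.

Lemma cos_pi3_gt0 : 0 < cos (pi / 3).
Proof. by apply: cos_gt0_pihalf; have := pi_gt0 R; lra. Qed.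

(** With digits 0 and 1 only, 0.b0 b1 ... in base 3 lies in [0, 1/6] if b0 = 0 and in [1/3, 1/2] if
    b0 = 1. On the first interval cos (2 pi s) >= cos (pi / 3), on the second, treated next, cos (2
    pi s) <= 0; the truncation to [0, 1] makes both values exact. *)
Lemma sch0 (s : R) : 0 <= s -> s <= 6^-1 -> sch s = 0.
Proof.
move=> s0 s1; rewrite /sch max_l//; rewrite ge_min; apply/orP; right.
have c0 := cos_pi3_gt0; rewrite subr_le0 mulrC ler_pdivlMr// mul1r.
have p0 := pi_gt0 R.
have h1 : pi * s <= pi * 6^-1 by rewrite ler_pM2l.
have h2 : 0 <= pi * s by rewrite mulr_ge0// ltW.
rewrite leNgt ltr_cos ?in_itv/= -?leNgt; lra.
Qed.

Lemma sch1 (s : R) : 3^-1 <= s -> s <= 2^-1 -> sch s = 1.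
Proof.
move=> s0 s1; rewrite /sch.
have c0 := cos_pi3_gt0; have p0 := pi_gt0 R.
have h1 : pi * s <= pi * 2^-1 by rewrite ler_pM2l.
have h2 : pi * 3^-1 <= pi * s by rewrite ler_pM2l.
have cs : cos (2 * pi * s) <= 0.
  rewrite -cos_pihalf leNgt ltr_cos ?in_itv/= -?leNgt; lra.
rewrite min_l ?max_r ?ler01// lerBrDr gerDl.
by rewrite mulr_ge0_le0 ?invr_ge0 ?(ltW c0).
Qed.

Definition base3 (b : nat -> bool) (N : nat) : R := \sum_(0 <= l < N) (b l)%:R / 3 ^+ l.+1.

Lemma base3S b N : 3 * base3 b N.+1 = (b 0)%:R + base3 (b \o S) N.
Proof.
rewrite /base3 big_nat_recl// mulrDr expr1 mulrCA divff ?mulr1 ?pnatr_eq0//.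
by congr (_ + _); rewrite mulr_sumr; apply: eq_bigr => l _ /=; rewrite (exprS 3 l.+1); field; rewrite expf_neq0.
Qed.

Lemma base3_bound b N : 0 <= base3 b N <= 2^-1.
Proof.
elim: N b => [|N IH] b; first by rewrite /base3 big_geq// lexx invr_ge0 ler0n.
have := base3S b N; have /andP[h1 h2] := IH (b \o S) => h.
by case: (b 0) h => /= h; lra.
Qed.

(** Multiplication by 3^k moves the first k digits into the integer part, which period 1 discards;
    past the end of the expansion the digits read as 0. *)
Lemma sch_base3 k b N : sch (3 ^+ k * base3 b N) = if (k < N)%N then (b k)%:R else 0.
Proof.
elim: k b N => [|k IH] b [|N]; rewrite ?ltnS.
- by rewrite /base3 big_geq// mulr0 sch0// invr_ge0.
- rewrite expr0 mul1r leq0n; have := base3S b N; have /andP[h1 h2] := base3_bound (b \o S) N.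
  by case: (b 0) => /= h; [rewrite sch1|rewrite sch0]; lra.
- by rewrite /base3 big_geq// mulr0 sch0// invr_ge0.
- rewrite exprSr -mulrA base3S mulrDr addrC.
  have -> : 3 ^+ k * (b 0%N)%:R = (3 ^ k * b 0%N)%:R :> R by rewrite natrM natrX.
  by rewrite schD IH.
Qed.

Definition bindigit (a : R) (j : nat) : bool := odd (Num.trunc (2 ^+ j.+1 * a)).

Lemma trunc_double (y : R) : 0 <= y -> (Num.trunc (2 * y))./2 = Num.trunc y.
Proof.
move=> y0; symmetry; apply: truncn_def.
have /truncn_itv/andP[h1 h2] : 0 <= 2 * y by rewrite mulr_ge0.
have := odd_double_half (Num.trunc (2 * y)).
move: h1 h2; move: (Num.trunc _) => t; move: (odd t) (t./2) => o h h1 h2 e.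
move: h1 h2; rewrite -e -addnn -!natr1 !natrD.
by case: o {e} => /= h1 h2; apply/andP; split; lra.
Qed.

Lemma sum_bindigit (a : R) n : 0 <= a -> a < 1 ->
  \sum_(0 <= j < n) (bindigit a j)%:R / 2 ^+ j.+1 = (Num.trunc (2 ^+ n * a))%:R / 2 ^+ n :> R.
Proof.
move=> a0 a1; elim: n => [|n IH].
  rewrite big_geq// expr0 mul1r divr1 (_ : Num.trunc a = 0%N)//.
  by apply: truncn_def; rewrite a0.
have p0 : 0 <= 2 ^+ n * a by rewrite mulr_ge0// exprn_ge0.
rewrite big_nat_recr//= IH -(trunc_double p0) mulrA -exprS /bindigit.
set t := Num.trunc _; rewrite -[in RHS](odd_double_half t) -addnn !natrD.
by rewrite exprS; field; rewrite expf_neq0.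
Qed.

Lemma trunc_approx (a : R) n : 0 <= a ->
  `|(Num.trunc (2 ^+ n * a))%:R / 2 ^+ n - a| <= 1 / 2 ^+ n.
Proof.
move=> a0; have p : 0 < 2 ^+ n :> R by rewrite exprn_gt0.
have /truncn_itv/andP[h1 h2] : 0 <= 2 ^+ n * a by rewrite mulr_ge0// ltW.
have -> : (Num.trunc (2 ^+ n * a))%:R / 2 ^+ n - a =
    ((Num.trunc (2 ^+ n * a))%:R - 2 ^+ n * a) / 2 ^+ n.
  by field; rewrite gt_eqF.
rewrite normrM normfV (gtr0_norm p) ler_pM2r ?invr_gt0//.
move: h1 h2; rewrite -natr1; set y := 2 ^+ n * a => h1 h2.
by rewrite ler_norml; lra.
Qed.

Variable d : nat.

(** The base 3 digit of t with index d j + i serves as the binary digit of index j of coordinate i,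
    so one parameter encodes d independent coordinates. *)
Definition curve_coord (i : nat) (t : R) : R :=
  fun_series (fun j (t : R) => 2^-1 * sch (3 ^+ (d * j + i) * t) / 2 ^+ j) t.

Lemma curve_coord_continuous_bound i :
  continuous (curve_coord i) /\ forall t, `|curve_coord i t| <= 2 * 1.
Proof.
apply: (fun_series_continuous (C := 1)) => j t.
  apply: (@continuousM R R (fun t => 2^-1 * sch (3 ^+ (d * j + i) * t)) (fun=> (2 ^+ j)^-1) t);
    last exact: cst_continuous.
  apply: (@continuousM R R (fun=> 2^-1) (fun t => sch (3 ^+ (d * j + i) * t)) t);
    first exact: cst_continuous.
  suff c : continuous (fun t : R => sch (3 ^+ (d * j + i) * t)) by exact: c.
  move=> s; apply: continuous_comp; last exact: sch_continuous.
  by apply: continuousM; [exact: cst_continuous|exact: cvg_id].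
have /andP[s0 s1] := sch01 (3 ^+ (d * j + i) * t).
rewrite ger0_norm ?divr_ge0 ?mulr_ge0 ?exprn_ge0//.
by rewrite ler_pM2r ?invr_gt0 ?exprn_gt0//; lra.
Qed.

Lemma curve_coord_continuous i : continuous (curve_coord i).
Proof. exact: (curve_coord_continuous_bound i).1. Qed.

Definition curve (t : R) : 'rV[R]_d := \row_i curve_coord i t.

Lemma curve_continuous : continuous curve.
Proof.
move=> t; apply/(@cvg_ballP _ _ _ _ (nbhs_filter t)) => e e0.
have H : \forall s \near t, forall i : 'I_d, `|curve_coord i t - curve_coord i s| < e.
  apply: (@filter_forall R 'I_d (fun i s => `|curve_coord i t - curve_coord i s| < e) (nbhs t) (nbhs_filter t)) => i.
  by have := @curve_coord_continuous i t => /cvgrPdist_lt/(_ _ e0).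
apply: filterS H => s Hs; split => // i j; rewrite !mxE.
exact: Hs.
Qed.

Lemma curve_surj : (0 < d)%N -> forall x : torus R d,
  exists2 t : R, 0 <= t <= 1 & tproj (curve t) = x.
Proof.
move=> d0 x.
pose a i := repr x 0 i - (Num.floor (repr x 0 i))%:~R.
have a01 i : 0 <= a i /\ a i < 1.
  have := floor_le (repr x 0 i); have := floorD1_gt (repr x 0 i).
  by rewrite /a intrD; set f := _%:~R => h1 h2; split; lra.
(* [b] interleaves the binary digits of the coordinates. Each [u n] is a finite expansion, at which
   the coordinates are exactly the truncations of [a] to n binary digits; a limit point of [u] is
   then a parameter of x by continuity. *)
pose b k := bindigit (a (Ordinal (ltn_pmod k d0))) (k %/ d).
pose u n := base3 b (d * n).
have un (i : 'I_d) n : curve_coord i (u n) = (Num.trunc (2 ^+ n * a i))%:R / 2 ^+ n.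
  rewrite -sum_bindigit; [|exact: (a01 i).1|exact: (a01 i).2].
  rewrite /curve_coord /fun_series.
  apply: cvg_lim => //; apply: (@cvg_near_cst _ _ _ _ _ _).
  (* The digits of [u n] from index d n on are 0, so the partial sums are constant from rank n. *)
  near=> m; rewrite /series /=.
  have nm : (n <= m)%N by near: m; exact: nbhs_infty_ge.
  rewrite (big_cat_nat (leq0n n) nm)//= [X in _ + X]big1_seq ?addr0.
    apply: eq_big_nat => j /andP[_ jn]; rewrite sch_base3.
    have -> : (d * j + i < d * n)%N.
      by rewrite (@leq_trans (d * j.+1))// ?leq_mul// mulnS addnC ltn_add2r.
    rewrite /b (mulnC d j) divnMDl// divn_small// addn0.
    rewrite (_ : Ordinal _ = i); last by apply/val_inj; rewrite /= modnMDl modn_small.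
    by rewrite exprS; field; rewrite expf_neq0.
  move=> j /andP[_]; rewrite mem_index_iota => /andP[nj _]; rewrite sch_base3.
  by rewrite ltnNge (leq_trans (leq_mul (leqnn d) nj)) ?leq_addr//= mulr0 mul0r.
have ub : bounded_fun u.
  exists 1; split => // M M1 n _; apply/ltW/(le_lt_trans _ M1).
  by have /andP[h1 h2] : 0 <= u n <= 2^-1 := base3_bound _ _; rewrite ger0_norm//; lra.
have [f fi cf] := bolzano_weierstrass ub.
pose t := limn (u \o f); exists t.
  have u01 n : 0 <= u (f n) <= 2^-1 := base3_bound _ _.
  apply/andP; split; [apply: limr_ge|apply: limr_le] => //; apply: nearW => n /=.
    by have /andP[] := u01 n.
  by have /andP[h1 h2] := u01 n; lra.
rewrite -[RHS]tproj_repr; apply/tproj_eqP/forallP => i; rewrite mxE.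
have -> : curve_coord i t = a i.
  have c1 : curve_coord i ((u \o f) n) @[n --> \oo] --> curve_coord i t.
    by apply: continuous_cvg; [exact: curve_coord_continuous|exact: cf].
  apply: (cvg_unique _ c1) => //.
  apply/cvgrPdist_lt => e e0; have [N Ne] := geometric_small 1 e0.
  near=> n; rewrite /= un distrC; apply: le_lt_trans Ne.
  apply: le_trans (trunc_approx _ (a01 i).1) _.
  rewrite ler_pM2l// lef_pV2 ?posrE ?exprn_gt0// ler_weXn2l ?ler1n//.
  apply: (@leq_trans n); first by near: n; exact: nbhs_infty_ge.
  exact: increasing_seq_ge.
by rewrite /a addrAC subrr sub0r rpredN intr_int.
Unshelve. all: end_near. Qed.

End Curve.

(** * Measures as images of Lebesgue measure under the curve *)

Section Coding.
Variables (R : realType) (d : nat) (d0 : (0 < d)%N).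
Local Notation T := (torus R d).

Definition tcurve (t : R) : T := tproj (curve d t).

Lemma tcurve_continuous : continuous tcurve.
Proof.
move=> t; apply: continuous_comp; first exact: curve_continuous.
exact: tproj_continuous.
Qed.

Lemma closed_torus_measurable (A : set T) : closed A -> measurable A.
Proof.
move=> cA; rewrite -(setCK A); apply: measurableC.
by apply: sub_sigma_algebra; exact: closed_openC.
Qed.

(* The smallest parameter of [x]: unlike an arbitrary section of the curve, it is
   measurable. *)
Definition code (x : T) : R := inf [set t | 0 <= t <= 1 /\ tcurve t = x].

(** The infimum is attained because the parameters of x form a closed set, points being closed in
    the Hausdorff torus. *)
Lemma codeP x : 0 <= code x <= 1 /\ tcurve (code x) = x.
Proof.
set A := [set t | 0 <= t <= 1 /\ tcurve t = x].
suff : A (code x) by [].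
have A0 : A !=set0 by have [t t01 tx] := curve_surj d0 x; exists t.
have Alb : has_lbound A by exists 0 => t [/andP[]].
have cA : closed A.
  have -> : A = `[0, 1]%classic `&` tcurve @^-1` [set x].
    by apply/seteqP; split => t; rewrite /A /= in_itv.
  apply: closedI; first exact: interval_closed.
  apply: preimage_closed; first by move=> t _; exact: tcurve_continuous.
  by apply: accessible_closed_set1; apply: hausdorff_accessible; exact: torus_hausdorff.
apply: cA => B /nbhs_ballP[e /= e0 eB].
have [t At te] := inf_adherent e0 (conj A0 Alb).
exists t; split => //; apply: eB; rewrite /ball /= distrC ger0_norm ?subr_ge0.
  by rewrite ltrBlDl.
exact: ge_inf.
Qed.

Lemma code_le x t : 0 <= t <= 1 -> tcurve t = x -> code x <= t.
Proof. by move=> t01 tx; apply: ge_inf => //; exists 0 => s [/andP[]]. Qed.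

(** Since [code] is the smallest parameter, the sublevel set is the image of [0, min 1 t] under the
    curve, hence compact and closed. *)
Lemma code_le_measurable t : measurable [set x | code x <= t].
Proof.
have -> : [set x | code x <= t] = tcurve @` `[0, Num.min 1 t]%classic.
  apply/seteqP; split => x /=.
    have [/andP[c0 c1] cx] := codeP x => ct; exists (code x) => //.
    by rewrite /= in_itv /= c0 le_min c1.
  move=> [s]; rewrite /= in_itv /= le_min => /andP[s0 /andP[s1 st]] sx.
  by apply: le_trans st; apply: code_le => //; rewrite s0.
apply: closed_torus_measurable; apply: compact_closed; first exact: torus_hausdorff.
apply: continuous_compact; first exact/continuous_subspaceT/tcurve_continuous.
exact: segment_compact.
Qed.

Lemma code_measurable : measurable_fun setT code.
Proof.
apply: (measurability _ (RGenOInfty.measurableE R)).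
move=> _ [_ [a ->] <-]; rewrite setTI.
rewrite (_ : _ @^-1` _ = ~` [set x | code x <= a]).
  by apply: measurableC; exact: code_le_measurable.
apply/seteqP; split => x /=; rewrite in_itv /= andbT.
  by move=> h; apply/negP; rewrite -ltNge.
by move=> /negP; rewrite -ltNge.
Qed.

Variable m : probability T R.

(** The generalized inverse of the distribution function of [code] under m. Admitting t = 1 for
    every s keeps the set nonempty even when s > 1, so the function is monotone on the whole line
    with values in [0, 1]. *)
Definition quantile (s : R) : R :=
  inf [set t | 0 <= t <= 1 /\ (t = 1 \/ (s%:E <= m [set x | (code x <= t)%R])%E)].

Lemma quantile01 s : 0 <= quantile s <= 1.
Proof.
apply/andP; split.
  apply: lb_le_inf; last by move=> t [/andP[]].
  by exists 1; rewrite /= ler01 lexx; split => //; left.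
apply: ge_inf; first by exists 0 => t [/andP[]].
by rewrite /= ler01 lexx; split => //; left.
Qed.

Lemma quantile_nd : nondecreasing_fun quantile.
Proof.
move=> s s' ss'; apply: lb_le_inf.
  by exists 1; rewrite /= ler01 lexx; split => //; left.
move=> t [t01 ts]; apply: ge_inf; first by exists 0 => u [/andP[]].
split => //; case: ts => [->|ts]; [by left|right].
by apply: le_trans ts; rewrite lee_fin.
Qed.

(** A Galois connection, due to the right continuity of the distribution function. The value t = 1
    is left out because it belongs to the defining set whatever s is. *)
Lemma quantile_le s t : 0 <= t -> t < 1 ->
  quantile s <= t <-> (s%:E <= m [set x | (code x <= t)%R])%E.
Proof.
move=> t0 t1; split; last first.
  move=> st; apply: ge_inf; first by exists 0 => u [/andP[]].
  by rewrite /= t0 ltW//; split => //; right.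
move=> qt.
have cv : m [set x | (code x <= t + n.+1%:R^-1)%R] @[n --> \oo] -->
    m (\bigcap_n [set x | (code x <= t + n.+1%:R^-1)%R]).
  apply: nonincreasing_cvg_mu => //.
  - by rewrite (le_lt_trans (probability_le1 _ _)) ?ltry//; exact: code_le_measurable.
  - by move=> n; exact: code_le_measurable.
  - by apply: bigcap_measurable => // n _; exact: code_le_measurable.
  - move=> n k nk; apply/subsetPset => x /= h; apply: le_trans h _.
    by rewrite lerD2l lef_pV2 ?posrE// ler_nat ltnS.
have e : \bigcap_n [set x | code x <= t + n.+1%:R^-1] = [set x | code x <= t].
  apply/seteqP; split => x /=.
    move=> h; apply/ler_addgt0Pr => e e0.
    have := h (Num.trunc e^-1) I; rewrite /= => h'; apply: le_trans h' _.
    rewrite lerD2l -[leRHS]invrK lef_pV2 ?posrE ?invr_gt0//.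
    exact/ltW/truncnS_gt.
  by move=> h n _ /=; apply: le_trans h _; rewrite lerDl invr_ge0.
rewrite e in cv; apply: (cvge_ge _ cv); near=> n.
have tn : t + n.+1%:R^-1 < 1.
  rewrite -ltrBrDl; near: n.
  by apply: (near_infty_natSinv_lt (PosNum _)); rewrite subr_gt0.
have Q0 : [set t | 0 <= t <= 1 /\ (t = 1 \/ (s%:E <= m [set x | (code x <= t)%R])%E)] !=set0.
  by exists 1; rewrite /= ler01 lexx; split => //; left.
have : quantile s < t + n.+1%:R^-1 by rewrite (le_lt_trans qt)// ltrDl invr_gt0.
move=> /(inf_lt Q0)[u [/andP[u0 u1] us] ut].
case: us => [u1'|su]; first by have := lt_trans ut tn; rewrite u1' ltxx.
apply: le_trans su _; apply: le_measure; rewrite ?inE; [exact: code_le_measurable..|].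
by move=> x /= h; rewrite (le_trans h)// ltW.
Unshelve. all: end_near. Qed.

Local Notation P0 := (uniform_prob (@ltr01 R)).

Lemma uniform_prob_le (y : R) : 0 <= y <= 1 -> P0 `]-oo, y]%classic = y%:E.
Proof.
move=> /andP[y0 y1]; rewrite /uniform_prob integral_uniform_pdf.
have -> : `]-oo, y]%classic `&` `[0, 1]%classic = `[0, y]%classic :> set R.
  apply/seteqP; split => s /=; rewrite !in_itv /=.
    by move=> [sy /andP[s0 _]]; rewrite s0.
  by move=> /andP[s0 sy]; rewrite s0 (le_trans sy y1).
rewrite (eq_integral (cst 1%E)); last first.
  move=> s; rewrite inE /= in_itv /= => /andP[s0 sy].
  by rewrite /uniform_pdf s0 (le_trans sy y1)/= subr0 invr1.
rewrite integral_cst//= mul1e lebesgue_measure_itv /= lte_fin.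
case: ltP => [_|y0']; first by rewrite -EFinD subr0.
by congr (_%:E); apply/eqP; rewrite eq_le y0 y0'.
Qed.

Lemma quantile_measurable : measurable_fun setT quantile.
Proof. exact: nondecreasing_measurable quantile_nd. Qed.

Lemma quantile_cdf t : P0 (quantile @^-1` `]-oo, t]%classic) = m (code @^-1` `]-oo, t]%classic).
Proof.
have codeE : code @^-1` `]-oo, t]%classic = [set x | code x <= t].
  by apply/seteqP; split => x /=; rewrite in_itv.
rewrite codeE; have [t0|t0] := ltP t 0.
  rewrite (_ : _ @^-1` _ = set0) ?measure0; last first.
    apply/seteqP; split => // s /=; rewrite in_itv /= => h.
    by have /andP[/le_trans/(_ h)] := quantile01 s; rewrite leNgt t0.
  rewrite (_ : [set x | _] = set0) ?measure0//.
  apply/seteqP; split => // x /= h.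
  by have [/andP[/le_trans/(_ h)]] := codeP x; rewrite leNgt t0.
have [t1|t1] := leP 1 t.
  rewrite (_ : _ @^-1` _ = setT) ?probability_setT; last first.
    apply/seteqP; split => // s _ /=; rewrite in_itv /=.
    by have /andP[_ /le_trans->] := quantile01 s.
  rewrite (_ : [set x | _] = setT) ?probability_setT//.
  apply/seteqP; split => // x _ /=.
  by have [/andP[_ /le_trans->]] := codeP x.
have mt := code_le_measurable t.
have fF : m [set x | (code x <= t)%R] \is a fin_num by exact: fin_num_measure.
pose y := fine (m [set x | (code x <= t)%R]).
have yE : m [set x | (code x <= t)%R] = y%:E by rewrite fineK.
rewrite yE -uniform_prob_le.
  congr (P0 _); apply/seteqP; split => s /=; rewrite !in_itv /=.
    by move=> /(quantile_le _ t0 t1); rewrite yE lee_fin.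
  by move=> h; apply/(quantile_le _ t0 t1); rewrite yE lee_fin.
rewrite -2!lee_fin -yE measure_ge0 /=; exact: probability_le1.
Qed.

Lemma measure_preimage_ocitv (d1 : measure_display) (X : measurableType d1)
  (mu : probability X R) (f : X -> R) (a b : R) : measurable_fun setT f -> a <= b ->
  mu (f @^-1` `]a, b]%classic) =
    (mu (f @^-1` `]-oo, b]%classic) - mu (f @^-1` `]-oo, a]%classic))%E.
Proof.
move=> mf ab; have mI (c : R) : measurable (f @^-1` `]-oo, c]%classic).
  by rewrite -[X in measurable X]setTI; apply: mf => //; exact: measurable_itv.
rewrite -(setIidr (_ : f @^-1` `]-oo, a]%classic `<=` f @^-1` `]-oo, b]%classic)); last first.
  by move=> x /=; rewrite !in_itv /= => h; exact: le_trans h ab.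
rewrite -measureD//; last by rewrite (le_lt_trans (probability_le1 _ (mI b))) ?ltry.
congr (mu _); apply/seteqP; split => x /=; rewrite !in_itv /=.
  by move=> /andP[h ->]; split => //; apply/negP; rewrite -ltNge.
by move=> [-> /negP]; rewrite -ltNge => ->.
Qed.

(** [quantile] under the uniform law and [code] under m have the same distribution function, hence
    the same law; the curve then takes [code x] back to x. *)
Lemma quantile_law (A : set T) : measurable A ->
  P0 ((fun s => tcurve (quantile s)) @^-1` A) = m A.
Proof.
move=> mA.
have mtc : measurable_fun setT tcurve.
  apply: (measurability _ (erefl (@measurable _ T))) => _ [B oB <-].
  rewrite setTI; apply: open_measurable.
  by have /continuousP := tcurve_continuous; apply.
have mD : measurable (tcurve @^-1` A) by rewrite -[X in measurable X]setTI; exact: mtc.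
have qm : measurable_fun [set: measurableTypeR R] (quantile : measurableTypeR R -> measurableTypeR R).
  exact: quantile_measurable.
pose mq := isMeasurableFun.Build _ _ _ _ _ qm.
pose q : {mfun measurableTypeR R >-> measurableTypeR R} :=
  HB.pack (quantile : measurableTypeR R -> measurableTypeR R) mq.
have cm : measurable_fun [set: T] (code : T -> measurableTypeR R).
  exact: code_measurable.
pose mc := isMeasurableFun.Build _ _ _ _ _ cm.
pose c : {mfun T >-> measurableTypeR R} := HB.pack (code : T -> measurableTypeR R) mc.
have H : forall B : set (measurableTypeR R), measurable B -> distribution P0 q B = distribution m c B.
  move=> B mB; apply: (@measure_unique _ R (measurableTypeR R) (@ocitv R) (fun k => `]- k%:R, k%:R]%classic)
    _ _ _ _ (distribution P0 q) (distribution m c)) => //.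
  - exact: ocitvI.
  - by move=> k; exact: is_ocitv.
  - apply/seteqP; split => // x _; exists (Num.trunc `|x|).+1 => //=.
    have := truncnS_gt `|x|; rewrite in_itv /= ltr_norml => /andP[-> /ltW ->] //.
  - move=> _ [[a b] _ <-] /=; have [ab|ba] := leP a b; last first.
      by rewrite set_itv_ge ?measure0// bnd_simp -leNgt ltW.
    rewrite /distribution /pushforward /=.
    transitivity (P0 (quantile @^-1` `]-oo, b]%classic) - P0 (quantile @^-1` `]-oo, a]%classic))%E.
      by apply: measure_preimage_ocitv ab; exact: quantile_measurable.
    rewrite !quantile_cdf; apply/esym.
    by apply: measure_preimage_ocitv ab; exact: code_measurable.
  - move=> k; rewrite (le_lt_trans (probability_le1 _ _)) ?ltry//.
have := H _ mD; rewrite /distribution /pushforward /= => h.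
transitivity (m (code @^-1` (tcurve @^-1` A))); first exact: h.
by congr (m _); apply/seteqP; split => x /=; rewrite (codeP x).2.
Qed.

End Coding.

(** * Compactness of the probability measures on the torus *)

Section Law.
Context {d1 d2 : measure_display} {X : measurableType d1} {Y : measurableType d2} {R : realType}.
Variables (mu : probability X R) (f : X -> Y) (mf : measurable_fun setT f).

Definition mfun_of : {mfun X >-> Y} := HB.pack f (isMeasurableFun.Build _ _ _ _ f mf).

Definition law : probability Y R := distribution mu mfun_of.

Lemma lawE A : law A = mu (f @^-1` A).
Proof. by []. Qed.

End Law.

Section BoundedIntegral.
Context {d1 : measure_display} {X : measurableType d1} {R : realType}.
Variable mu : {finite_measure set X -> \bar R}.

Lemma bounded_integrable (h : X -> R) (M : R) : measurable_fun setT h ->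
  (forall x, `|h x| <= M) -> mu.-integrable setT (EFin \o h).
Proof.
move=> mh hM; apply: measurable_bounded_integrable => //.
  by rewrite ltey_eq fin_num_measure.
exists M; split; first exact: num_real.
by move=> N MN x _ /=; rewrite (le_trans (hM x))// ltW.
Qed.

Lemma Rintegral_cvg (h_ : nat -> X -> R) (h : X -> R) (M : R) :
  (forall k, measurable_fun setT (h_ k)) -> measurable_fun setT h ->
  (forall k x, `|h_ k x| <= M) ->
  {ae mu, forall x, h_ ^~ x @ \oo --> h x} ->
  \int[mu]_x h_ k x @[k --> \oo] --> \int[mu]_x h x.
Proof.
move=> mh_ mh hM cv.
have [|||||i1 _ c] := @dominated_convergence _ X R mu setT measurableT
  (fun k => EFin \o h_ k) (EFin \o h) (cst M%:E).
- by move=> k; exact/measurable_EFinP.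
- exact/measurable_EFinP.
- by apply: filterS cv => x cx _; apply/fine_cvgP; split; [exact: nearW|exact: cx].
- exact: (bounded_integrable (h := cst M) (M := `|M|)).
- by apply: filterE => x k _ /=; rewrite lee_fin.
apply: fine_cvg; rewrite fineK; last exact: integrable_fin_num.
exact: c.
Qed.

Lemma Rintegral_norm_le (h : X -> R) (M : R) : measurable_fun setT h ->
  (forall x, `|h x| <= M) -> `|\int[mu]_x h x| <= M * fine (mu setT).
Proof.
move=> mh hM; have ih := bounded_integrable mh hM.
apply: le_trans (le_normr_Rintegral measurableT ih) _.
rewrite -Rintegral_cst//; apply: le_Rintegral => //.
- by apply: (bounded_integrable (M := M)) => [|x]; [exact: measurableT_comp|rewrite normr_id].
- apply: (bounded_integrable (M := `|M|)) => //.
Qed.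

End BoundedIntegral.

Import HBNNSimple.

Section TransportLaws.
Variables (R : realType) (d : nat).
Local Notation T := (torus R d).
Context {d1 : measure_display} {X : measurableType d1}.
Variable mu : probability X R.

Lemma Rintegral_law (f : X -> T) (m : probability T R) (h : T -> R) :
  measurable_fun setT f -> (forall A : set T, measurable A -> mu (f @^-1` A) = m A) ->
  continuous h -> \int[m]_x h x = \int[mu]_s h (f s).
Proof.
move=> mf fm ch; have mh := continuous_torus_measurable ch.
have [M M0 hM] := continuous_torus_bounded ch.
have il : (law mu mf).-integrable setT (EFin \o h) by exact: bounded_integrable mh hM.
rewrite /Rintegral; congr fine.
transitivity (\int[law mu mf]_x (h x)%:E)%E.
  by apply: eq_measure_integral => A mA _; first [exact: fm|exact: esym (fm _ mA)].
apply: (@integral_pushforward _ _ _ _ _ f mf mu setT (EFin \o h)) => //.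
  by apply/measurable_EFinP.
rewrite preimage_setT; apply: (@bounded_integrable _ _ _ mu (h \o f) M) => //.
by apply: measurableT_comp; [exact: mh|exact: mf].
by move=> x; exact: hM.
Qed.

(** The joint law of f and f' is a coupling. The cost [tdist] enters only through the simple
    functions below it, whose integrals are carried over to mu; this is why a measurable majorant g
    stands in the bound. *)
Lemma W1_le_integral (f f' : X -> T) (m m' : probability T R) (g : X -> R) :
  measurable_fun setT f -> measurable_fun setT f' ->
  (forall A : set T, measurable A -> mu (f @^-1` A) = m A) ->
  (forall A : set T, measurable A -> mu (f' @^-1` A) = m' A) ->
  measurable_fun setT g -> (forall s, tdist (f s) (f' s) <= g s) ->
  (W1 m m' <= \int[mu]_s (g s)%:E)%E.
Proof.
move=> mf mf' fm fm' mg fg.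
have mff : measurable_fun setT (fun s => (f s, f' s)) by exact: measurable_fun_pair.
have td0 (z : T * T) : (0 <= (tdist z.1 z.2)%:E)%E.
  rewrite lee_fin; apply: lb_le_inf; last by move=> _ [u _ [v _ <-]]; exact: sqrtr_ge0.
  exists (enorm (repr z.1 - repr z.2)); exists (repr z.1); first exact: tproj_repr.
  by exists (repr z.2) => //; exact: tproj_repr.
apply: (@le_trans _ _ (\int[law mu mff]_z (tdist z.1 z.2)%:E)%E).
  apply: ereal_inf_lbound; exists (law mu mff) => //.
  move=> A mA; split.
    have -> : law mu mff (A `*` setT) = mu (f @^-1` A).
      by rewrite lawE; congr (mu _); apply/seteqP; split => s /=; [case|split].
    exact: fm.
  have -> : law mu mff (setT `*` A) = mu (f' @^-1` A).
    by rewrite lawE; congr (mu _); apply/seteqP; split => s /=; [case|split].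
  exact: fm'.
rewrite ge0_integralTE//; apply: ub_ereal_sup => _ [h hle <-].
rewrite -integralT_nnsfun.
have mh : measurable_fun setT (fun z : T * T => (h z)%:E) by apply/measurable_EFinP.
have -> : (\int[law mu mff]_z (h z)%:E = \int[mu]_s (h (f s, f' s))%:E)%E.
  rewrite [LHS](ge0_integral_pushforward mff _ measurableT mh)//.
  by move=> z _; rewrite lee_fin.
apply: ge0_le_integral => //.
- by move=> s _; rewrite lee_fin.
- by apply/measurable_EFinP; apply: measurableT_comp.
- by apply/measurable_EFinP.
- move=> s _; rewrite lee_fin /=; apply: le_trans (fg s).
  by have := hle (f s, f' s); rewrite lee_fin.
Qed.

End TransportLaws.

(** * Helly's selection theorem *)

Section Helly.
Variable R : realType.

(** By Tychonoff's theorem the sequence has a cluster point for pointwise convergence.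
    Neighbourhoods in the product constrain finitely many coordinates, whence the finite list. *)
Lemma bounded_functions_cluster (q_ : nat -> R -> R) :
  (forall k s, 0 <= q_ k s <= 1) ->
  exists q : R -> R, (forall s, 0 <= q s <= 1) /\
    forall (l : seq R) (dl : R) (n : nat), 0 < dl -> exists2 k, (n <= k)%N &
      forall s, s \in l -> `|q s - q_ k s| < dl.
Proof.
move=> q01; pose K : R -> topologicalType := fun=> (R : topologicalType).
pose C : set (prod_topology K) := [set f | forall s, (`[0, 1]%classic : set (K s)) (f s)].
have cC : compact C.
  by apply: (@tychonoff R K (fun=> `[0, 1]%classic)) => s; exact: segment_compact.
pose F : set_system (prod_topology K) := [set B | exists n, forall k, (n <= k)%N -> B (q_ k)].
have FF : ProperFilter F.
  apply: Build_ProperFilter_ex.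
    by move=> B [n nB]; exists (q_ n); exact: nB.
  split.
  - by exists 0%N.
  - move=> A B [n nA] [m mB]; exists (maxn n m) => k; rewrite geq_max => /andP[nk mk].
    by split; [exact: nA|exact: mB].
  - by move=> A B AB [n nA]; exists n => k nk; apply: AB; exact: nA.
have FC : F C by exists 0%N => k _ s; rewrite /= in_itv; exact: q01.
have [q [Cq clq]] := cC F FF FC.
exists q; split; first by move=> s; have := Cq s; rewrite /= in_itv.
move=> l dl n dl0.
have nb : nbhs q [set f : prod_topology K | forall s, s \in l -> `|(q s : R) - f s| < dl].
  elim: l => [|s l IH]; first by apply: filterS filterT.
  have B : nbhs (q s) [set y : R | `|(q s : R) - y| < dl].
    by apply/nbhs_ballP; exists dl.
  have B' : nbhs q [set f : prod_topology K | `|(q s : R) - f s| < dl].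
    exact: (@proj_continuous R K s q _ B).
  apply: filterS (filterI B' IH) => f [f1 f2] t; rewrite inE => /predU1P[->|]; first exact: f1.
  exact: f2.
have FB : F [set q_ k | k in [set k | (n <= k)%N]] by exists n => k nk; exists k.
by have [_ [[k /= nk <-] Bk]] := clq _ _ FB nb; exists k.
Qed.

(** A cluster point in an uncountable product does not by itself give a convergent subsequence, but
    [q_ (e k)] can be taken 1/(k + 1)-close to q at the first k rationals. It then converges at all
    rationals, and monotonicity squeezes it at points where q has no jump. *)
Lemma helly (q_ : nat -> R -> R) :
  (forall k, nondecreasing_fun (q_ k)) -> (forall k s, 0 <= q_ k s <= 1) ->
  exists e : nat -> nat, (forall k, (k <= e k)%N) /\ exists q : R -> R,
  [/\ nondecreasing_fun q, forall s, 0 <= q s <= 1 &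
   forall s, ~ discontinuity q s -> q_ (e k) s @[k --> \oo] --> q s].
Proof.
move=> qnd q01; have [q [Kq pick]] := bounded_functions_cluster q01.
have q_nd : nondecreasing_fun q.
  move=> s t st; rewrite leNgt; apply/negP => h.
  have dl0 : 0 < (q s - q t) / 2 by rewrite divr_gt0// subr_gt0.
  have [k _ h12] := pick [:: s; t] _ 0%N dl0.
  have h1 := h12 s (mem_head _ _).
  have h2 : `|q t - q_ k t| < (q s - q t) / 2 by apply: h12; rewrite !inE eqxx orbT.
  have := qnd k _ _ st; move: h1 h2; rewrite !ltr_norml => /andP[h1 h1'] /andP[h2 h2'] h3.
  lra.
pose r (i : nat) : R := ratr (odflt 0 (unpickle i : option rat)).
have /choice[e eP] : forall k, exists k', (k <= k')%N /\
    forall i : 'I_k, `|q (r i) - q_ k' (r i)| < k.+1%:R^-1.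
  move=> k; have [|k' kk' h] := pick [seq r i | i <- iota 0 k] k.+1%:R^-1 k.
    by rewrite invr_gt0.
  by exists k'; split => // i; apply: h; apply: map_f; rewrite mem_iota /=.
exists e; split; first by move=> k; exact: (eP k).1.
exists q; split => //.
have cr (z : rat) : q_ (e k) (ratr z) @[k --> \oo] --> q (ratr z).
  have -> : ratr z = r (pickle z) by rewrite /r pickleK.
  apply/cvgrPdist_lt => ep ep0; near=> k.
  have ik : (pickle z < k)%N by near: k; exact: nbhs_infty_gt.
  have := (eP k).2 (Ordinal ik) => /lt_trans; apply.
  by near: k; exact: (near_infty_natSinv_lt (PosNum ep0)).
move=> s ndis.
have cl : cvg (q x @[x --> s^'-]).
  apply: nondecreasing_at_left_is_cvgr.
    by apply: nearW => x y z _ _; exact: q_nd.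
  by apply: nearW => x; exists 1 => _ [y _ <-]; have /andP[] := Kq y.
have cr' : cvg (q x @[x --> s^'+]).
  apply: nondecreasing_at_right_is_cvgr.
    by apply: nearW => x y z _ _; exact: q_nd.
  by apply: nearW => x; exists 0 => _ [y _ <-]; have /andP[] := Kq y.
(* A bounded monotone function has both one-sided limits, so the absence of a discontinuity means
   that they agree. *)
have el : lim (q x @[x --> s^'-]) = lim (q x @[x --> s^'+]).
  by apply: contrapT => /eqP ne; apply: ndis; split.
apply/cvgrPdist_lt => ep ep0.
have ep3 : 0 < ep / 3 by rewrite divr_gt0.
have [r1 r1s h1] : exists2 z : rat, ratr z < s & `|lim (q x @[x --> s^'-]) - q (ratr z)| < ep / 3.
  have := cl => /cvgrPdist_lt/(_ _ ep3)[dl /= dl0 dlP].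
  have [z] : exists z : rat, ratr z \in `]s - dl, s[ by apply: rat_in_itvoo; rewrite gtrBl.
  rewrite in_itv /= => /andP[z1 z2]; exists z => //; apply: dlP => //=.
  by rewrite gtr0_norm ?subr_gt0//; lra.
have [r2 r2s h2] : exists2 z : rat, s < ratr z & `|lim (q x @[x --> s^'+]) - q (ratr z)| < ep / 3.
  have := cr' => /cvgrPdist_lt/(_ _ ep3)[dl /= dl0 dlP].
  have [z] : exists z : rat, ratr z \in `]s, s + dl[ by apply: rat_in_itvoo; rewrite ltrDl.
  rewrite in_itv /= => /andP[z1 z2]; exists z => //; apply: dlP => //=.
  by rewrite ltr0_norm ?subr_lt0//; lra.
rewrite -el in h2.
have n1 := cr r1; move: n1 => /cvgrPdist_lt/(_ _ ep3) n1.
have n2 := cr r2; move: n2 => /cvgrPdist_lt/(_ _ ep3) n2.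
near=> k.
have m1 : `|q (ratr r1) - q_ (e k) (ratr r1)| < ep / 3 by near: k.
have m2 : `|q (ratr r2) - q_ (e k) (ratr r2)| < ep / 3 by near: k.
have m3 := qnd (e k) _ _ (ltW r1s); have m4 := qnd (e k) _ _ (ltW r2s).
have m5 := q_nd _ _ (ltW r1s); have m6 := q_nd _ _ (ltW r2s).
move: h1 h2 m1 m2 m3 m4 m5 m6; set L := lim _.
rewrite !ltr_norml => /andP[h1 h1'] /andP[h2 h2'] /andP[m1 m1'] /andP[m2 m2'] m3 m4 m5 m6.
apply/andP; split; lra.
Unshelve. all: end_near. Qed.

End Helly.

Section Compactness.
Variables (R : realType) (d : nat) (d0 : (0 < d)%N).
Local Notation T := (torus R d).

Definition unit_prob : probability (measurableTypeR R) R := uniform_prob (@ltr01 R).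
Local Notation P0 := unit_prob.

(** The uniform law is a measure on the whole line, so the complement of [0, 1] goes into the null
    set. *)
Lemma uniform_prob_countable (C : set R) : countable C ->
  {ae P0, forall s, `[0, 1]%classic s /\ ~ C s}.
Proof.
move=> cC.
have mC : measurable (C : set (measurableTypeR R)) by exact: countable_measurable.
exists (C `|` ~` `[0, 1]%classic); split.
- by apply: measurableU => //; apply: measurableC; exact: measurable_itv.
- rewrite /= /unit_prob /= /uniform_prob integral_uniform_pdf; apply: null_set_integral.
  + apply: measurableI; last exact: measurable_itv.
    by apply: measurableU => //; apply: measurableC; exact: measurable_itv.
  + apply: measurable_funTS; apply/measurable_EFinP.
    exact: measurable_uniform_pdf.
  + apply: countable_lebesgue_measure0; apply: sub_countable cC.
    by apply: subset_card_le => s [[//|]].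
- move=> s /= /not_andP[h|/contrapT h]; [by right|by left].
Qed.

Lemma quantile_law_measurable (q : R -> R) : nondecreasing_fun q ->
  measurable_fun [set: measurableTypeR R] ((fun s => tcurve d (q s)) : measurableTypeR R -> T).
Proof.
move=> qnd.
have tm : measurable_fun setT (tcurve d : measurableTypeR R -> T).
  apply: (measurability _ (erefl (@measurable _ T))) => _ [B oB <-].
  rewrite setTI; apply: open_measurable.
  by have /continuousP := @tcurve_continuous R d; apply.
have qm : measurable_fun setT (q : measurableTypeR R -> measurableTypeR R).
  exact: nondecreasing_measurable.
exact: measurableT_comp tm qm.
Qed.

(** All the measures become laws on one probability space, where the quantile functions converge
    almost everywhere. Dominated convergence then yields both conclusions, the one on [W1] through
    joint laws. *)
Lemma prob_compact (m_ : nat -> probability T R) :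
  exists e : nat -> nat, (forall k, (k <= e k)%N) /\ exists m : probability T R,
    (forall dl : R, 0 < dl -> \forall k \near \oo, (W1 m (m_ (e k)) < dl%:E)%E) /\
    forall h : T -> R, continuous h ->
      \int[m_ (e k)]_x h x @[k --> \oo] --> \int[m]_x h x.
Proof.
have [e [ke [q [qnd q01 qcv]]]] := helly (fun k => @quantile_nd R d (m_ k))
  (fun k s => @quantile01 R d (m_ k) s).
exists e; split => //.
have mX := quantile_law_measurable qnd.
exists (law P0 mX).
pose X_ k (s : measurableTypeR R) := tcurve d (quantile (m_ (e k)) s).
pose X (s : measurableTypeR R) := tcurve d (q s).
have mX_ k : measurable_fun setT (X_ k).
  exact: (quantile_law_measurable (@quantile_nd R d (m_ (e k)))).
have lX_ k A : measurable A -> P0 (X_ k @^-1` A) = m_ (e k) A.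
  by move=> mA; exact: quantile_law.
(* An open interval containing [0, 1], so that the endpoints are covered. *)
have cC : countable [set s | s \in (`](-1), 2[) /\ discontinuity q s].
  by apply: discontinuity_countable => x y _ _; exact: qnd.
have aecv : {ae P0, forall s, quantile (m_ (e k)) s @[k --> \oo] --> q s}.
  have [N [mN N0 sN]] := uniform_prob_countable cC.
  exists N; split => // s ns; apply: sN => /= -[s01 nC]; apply: ns; apply: qcv => dis.
  apply: nC; split => //; move: s01; rewrite /= !in_itv /= => /andP[h1 h2].
  by apply/andP; split; lra.
have FP0 : Filter (nbhs (almost_everywhere P0)) := ae_filter_ringOfSetsType P0.
split; last first.
  move=> h ch; have [M M0 hM] := continuous_torus_bounded ch.
  have mh := continuous_torus_measurable ch.
  have -> : \int[law P0 mX]_x h x = \int[P0]_s h (X s).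
    exact: (@Rintegral_law _ _ _ _ P0 X).
  under eq_cvg => k do rewrite (@Rintegral_law _ _ _ _ P0 (X_ k) _ h (mX_ k) (lX_ k) ch).
  apply: (Rintegral_cvg (M := M)) => //.
  - by move=> k; apply: measurableT_comp.
  - by apply: measurableT_comp mX.
  - apply: filterS aecv => s cs.
    apply: continuous_cvg; first exact: ch.
    by apply: continuous_cvg cs; exact: tcurve_continuous.
(* The distance between the lifts in R^d: a majorant of [tdist] that is continuous in both
   parameters. *)
pose g (s t : R) := enorm (curve d s - curve d t).
have cg t : continuous (g ^~ t).
  move=> s; apply: continuous_comp; last exact: enorm_continuous.
  by apply: continuousB; [exact: curve_continuous|exact: cst_continuous].
have cg' t : continuous (g t).
  move=> s; apply: continuous_comp; last exact: enorm_continuous.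
  by apply: continuousB; [exact: cst_continuous|exact: curve_continuous].
have gM : exists M : R, forall s t, g s t <= M.
  (* Coordinates of the curve are at most 2 in absolute value, so they differ by at most 4. *)
  exists (Num.sqrt (\sum_(i < d) 4 * 4)) => s t; apply: ler_wsqrtr.
  apply: ler_sum => i _; rewrite !mxE -expr2 -[leRHS]expr2.
  have := (@curve_coord_continuous_bound R d i).2 s.
  have := (@curve_coord_continuous_bound R d i).2 t; rewrite !ler_norml => /andP[h1 h2] /andP[h3 h4].
  by rewrite -[leLHS]real_normK ?num_real// ler_sqr ?nnegrE// ler_norml; lra.
have [M gM'] := gM.
have mg k : measurable_fun [set: measurableTypeR R] (fun s => g (q s) (quantile (m_ (e k)) s)).
  have -> : (fun s => g (q s) (quantile (m_ (e k)) s)) = (fun s => Num.sqrt (\sum_(i < d)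
      (curve_coord d i (q s) - curve_coord d i (quantile (m_ (e k)) s)) ^+ 2)).
    by apply/funext => s; congr Num.sqrt; apply: eq_bigr => i _; rewrite !mxE expr2.
  apply: measurableT_comp; first exact: continuous_measurable_fun (@sqrt_continuous R).
  apply: measurable_sum => i; apply: measurable_funX; apply: measurable_funB.
    apply: measurableT_comp; first exact: continuous_measurable_fun (@curve_coord_continuous R d i).
    exact: nondecreasing_measurable.
  apply: measurableT_comp; first exact: continuous_measurable_fun (@curve_coord_continuous R d i).
  by apply: nondecreasing_measurable => //; exact: quantile_nd.
have wl k : (W1 (law P0 mX) (m_ (e k)) <= \int[P0]_s (g (q s) (quantile (m_ (e k)) s))%:E)%E.
  apply: (@W1_le_integral _ _ _ _ P0 X (X_ k)) => // [A mA|s].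
    exact: lX_.
  exact: tdist_bound.
have g0 s t : 0 <= g s t by exact: sqrtr_ge0.
have gi k : P0.-integrable setT (fun s => (g (q s) (quantile (m_ (e k)) s))%:E).
  by apply: (@bounded_integrable _ _ _ _ _ M) => // s; rewrite ger0_norm.
have : \int[P0]_s g (q s) (quantile (m_ (e k)) s) @[k --> \oo] --> \int[P0]_s (cst 0 s : R).
  apply: (Rintegral_cvg (M := M)) => //.
  - by move=> k x; rewrite ger0_norm.
  - apply: filterS aecv => s cs.
    rewrite (_ : cst 0 s = g (q s) (q s)); last by rewrite /g subrr enorm0.
    by apply: continuous_cvg cs; exact: cg'.
rewrite Rintegral_cst// mul0r => /cvgrPdist_lt ci dl dl0.
apply: filterS (ci dl dl0) => k; rewrite sub0r normrN ger0_norm; last first.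
  by apply: Rintegral_ge0.
move=> h; apply: le_lt_trans (wl k) _.
by rewrite -(fineK (integrable_fin_num measurableT (gi k))) lte_fin.
Qed.

End Compactness.

(** * A countable separating family of C^2 functions *)

Section Separation.
Variables (R : realType) (d : nat).
Local Notation T := (torus R d).
Local Notation pi := (@pi R).

(** One minus a C^2 bump around a rational centre. With the complement of a bump, products of such
    functions approach the indicator of a closed set. *)
Definition cobump (p : 'rV[rat]_d * nat) (x : T) : R :=
  1 - Num.max 0 (1 - p.2.+1%:R * torus_gap (map_mx ratr p.1) x) ^+ 3.

Lemma cobump01 p x : 0 <= cobump p x <= 1.
Proof.
have g0 : 0 <= p.2.+1%:R * torus_gap (map_mx ratr p.1) x.
  by rewrite mulr_ge0// torus_gap_ge0.
rewrite /cobump subr_ge0 gerBl exprn_ge0 ?le_max ?lexx// andbT.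
by rewrite exprn_ile1 ?le_max ?lexx// ge_max ler01 gerBl.
Qed.

Lemma cobump_lt1 p x : cobump p x < 1 <-> torus_gap (map_mx ratr p.1) x < p.2.+1%:R^-1.
Proof.
rewrite /cobump -[X in _ < X]subr0 ltrD2l ltrN2 -[X in _ <-> _ < X]mul1r ltr_pdivlMr//.
rewrite mulrC; set s := _ * _; split => h; last first.
  by rewrite exprn_gt0// lt_max subr_gt0 h orbT.
rewrite ltNge; apply/negP => s1; move: h.
by rewrite max_l ?subr_le0// expr0n ltxx.
Qed.

Lemma tC2_cobump p : tC2 (cobump p).
Proof.
apply: (@Ck_sub _ _ 2 (fun=> 1)); first exact: Ck_cst.
apply: (@Ck_comp _ _ 2 (fun s : R => Num.max 0 s ^+ 3)
  (fun b => 1 - p.2.+1%:R * tlift (torus_gap (map_mx ratr p.1)) b)).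
  exact: smooth1_pospow.
apply: Ck_sub; first exact: Ck_cst.
by apply: Ck_scale; exact: Ck_gap.
Qed.

(** The sets where some cobump is below 1 thus form a base of the topology, and a countable one
    since centres and radii are indexed by rationals and naturals. *)
Lemma cobump_base (O : set T) x : open O -> O x ->
  exists p, cobump p x < 1 /\ forall y, cobump p y < 1 -> O y.
Proof.
move=> oO Ox; pose b := repr x.
have : nbhs b (@tproj R d @^-1` O).
  apply: (@tproj_continuous R d b); rewrite tproj_repr.
  exact: open_nbhs_nbhs.
move=> /nbhs_ballP[dl /= dl0 dlP].
(* Half of [dl] is spent from b to the rational centre, half from the centre to a representative of
   y; the bound 1/2 is the range of [torus_gap_lt]. *)
pose eta := Num.min (dl / 2) 2^-1.
have eta0 : 0 < eta by rewrite lt_min divr_gt0//=.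
have eta1 : eta <= 2^-1 by rewrite ge_min lexx orbT.
have eta2 : eta <= dl / 2 by rewrite ge_min lexx.
have p0 := pi_gt0 R.
have c0 : 0 < 1 - cos (2 * pi * eta).
  suff : cos (2 * pi * eta) < cos 0 by rewrite cos0 subr_gt0.
  have h1 : pi * eta <= pi * 2^-1 by rewrite ler_pM2l.
  have h2 : 0 < pi * eta by rewrite mulr_gt0.
  by rewrite ltr_cos ?in_itv/= ?lexx ?(ltW p0)//; lra.
pose N := Num.trunc (1 - cos (2 * pi * eta))^-1.
have hN : N.+1%:R^-1 < 1 - cos (2 * pi * eta).
  by rewrite -[ltRHS]invrK ltf_pV2 ?posrE ?invr_gt0//; exact: truncnS_gt.
(* The share of one coordinate in a gap below 1/(N + 1); dividing by d + 1 keeps the sum of d shares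
   strictly below, d = 0 included. *)
have ep0 : 0 < (N.+1%:R * d.+1%:R)^-1 :> R by rewrite invr_gt0 mulr_gt0.
have [rho /= rho0 rhoP] : exists2 rho : R, 0 < rho &
    forall t, `|t| < rho -> 1 - cos (2 * pi * t) < (N.+1%:R * d.+1%:R)^-1.
  have cc : continuous (fun t : R => cos (2 * pi * t)).
    move=> t; apply: continuous_comp; last exact: continuous_cos.
    by apply: continuousM; [exact: cst_continuous|exact: cvg_id].
  have /cvgrPdist_lt/(_ _ ep0)[rho /= rho0 rhoP] := cc 0.
  exists rho => // t tr; have := rhoP t; rewrite /= sub0r normrN mulr0 cos0 => /(_ tr).
  exact: le_lt_trans (ler_norm _).
have [a aP] : exists a : 'I_d -> rat, forall i, `|b 0 i - ratr (a i)| < Num.min rho (dl / 2).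
  suff H : forall i : 'I_d, exists q : rat, `|b 0 i - ratr q| < Num.min rho (dl / 2).
    by have [a aP] := choice H; exists a.
  move=> i; set mu := Num.min _ _.
  have mu0 : 0 < mu by rewrite lt_min rho0 divr_gt0.
  have [q] : exists q : rat, ratr q \in `]b 0 i, b 0 i + mu[ by apply: rat_in_itvoo; rewrite ltrDl.
  rewrite in_itv /= => /andP[q1 q2]; exists q.
  by rewrite ltr0_norm ?subr_lt0//; lra.
pose am : 'rV[rat]_d := \row_i a i.
exists (am, N); split.
  apply/cobump_lt1 => /=.
  have := tlift_gap (map_mx ratr am) b; rewrite /tlift tproj_repr => ->.
  apply: (@le_lt_trans _ _ (\sum_(i < d) (N.+1%:R * d.+1%:R)^-1)).
    apply: ler_sum => i _; rewrite !mxE; apply/ltW/rhoP.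
    by have := aP i; rewrite lt_min => /andP[].
  rewrite sumr_const card_ord -[X in X < _]mulr_natr invfM -mulrA gtr_pMr ?invr_gt0//.
  by rewrite mulrC ltr_pdivrMr// mul1r ltr_nat.
move=> y /cobump_lt1/= gy.
have [c [cy cP]] : exists c, tproj c = y /\ forall i, `|c 0 i - map_mx ratr am 0 i| < eta.
  rewrite -(tproj_repr y); apply: torus_gap_lt => //.
  by rewrite tproj_repr; exact: lt_trans gy hN.
rewrite -cy; apply: dlP; split => // i j; rewrite ord1 /ball /=.
have := cP j; have := aP j; rewrite lt_min !mxE => /andP[_ h1] h2.
have -> : b 0 j - c 0 j = (b 0 j - ratr (a j)) - (c 0 j - ratr (a j)) by ring.
by apply: le_lt_trans (ler_normB _ _) _; lra.
Qed.

Lemma prod01 (I : Type) (s : seq I) (F : I -> R) :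
  (forall j, 0 <= F j <= 1) -> 0 <= \prod_(j <- s) F j <= 1.
Proof.
move=> F01; elim: s => [|p s /andP[h0 h1]]; first by rewrite big_nil ler01 lexx.
by have /andP[c0 c1] := F01 p; rewrite big_cons mulr_ge0//= mulr_ile1.
Qed.

Lemma prod01_le (I : eqType) (s : seq I) (F : I -> R) i :
  (forall j, 0 <= F j <= 1) -> i \in s -> \prod_(j <- s) F j <= F i.
Proof.
move=> F01; elim: s => // j s IH; have /andP[h0 h1] := F01 j.
have /andP[p0 p1] := prod01 s F01.
rewrite inE big_cons => /predU1P[->|/IH h]; first by rewrite ler_piMr.
by apply: le_trans h; rewrite ler_piMl.
Qed.

Definition test_fun (s : seq ('rV[rat]_d * nat)) (x : T) : R := \prod_(p <- s) cobump p x.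

Lemma test_fun01 s x : 0 <= test_fun s x <= 1.
Proof.
by apply: prod01 => p; exact: cobump01.
Qed.

Lemma tC2_test_fun s : tC2 (test_fun s).
Proof. by apply: (@Ck_prod _ _ 2 _ s (fun p => tlift (cobump p))) => p; exact: tC2_cobump. Qed.

Lemma test_fun_continuous s : continuous (test_fun s).
Proof. exact/tlift_continuous/(Ck_continuous (tC2_test_fun s)). Qed.

(** Closed sets come first. Products of cobumps equal to 1 on C are 1 on C, and their increasing
    powers tend to 0 at each outside point, since one of the factors is below 1 there; dominated
    convergence gives m C = m' C. Complements give the open sets, which are stable under
    intersection and generate the sigma-algebra. *)
Lemma test_fun_separating (m m' : probability T R) :
  (forall s, \int[m]_x test_fun s x = \int[m']_x test_fun s x) -> same_measure m m'.
Proof.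
move=> mm'.
have closed_eq (C : set T) : closed C -> m C = m' C.
  move=> cC; pose good (p : 'rV[rat]_d * nat) := `[< forall y, cobump p y < 1 -> ~ C y >].
  pose idx (i : nat) : seq ('rV[rat]_d * nat) := if unpickle i is Some p then
    if good p then [:: p] else [::] else [::].
  (* [l n] lists the indices coded below n whose cobump is 1 on C. Repeating it n times turns the
     product into its n-th power, which is again a test function. *)
  pose l n := flatten [seq idx i | i <- iota 0 n].
  pose s n := flatten (nseq n (l n)).
  have mC := closed_torus_measurable cC.
  have lgood n p : p \in l n -> good p.
    move=> /flattenP[l' /mapP[i _ ->]]; rewrite /idx; case: unpickle => // q.
    by case: ifP => // gq; rewrite inE => /eqP ->.
  have sE n x : test_fun (s n) x = test_fun (l n) x ^+ n.
    suff H k : test_fun (flatten (nseq k (l n))) x = test_fun (l n) x ^+ k by exact: H.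
    elim: k => [|k IH] /=; first by rewrite /test_fun big_nil expr0.
    by rewrite /test_fun big_cat /= exprS -IH.
  have cv x : test_fun (s n) x @[n --> \oo] --> (\1_C x : R).
    have [Cx|nCx] := pselect (C x).
      rewrite indicE mem_set//.
      apply: cvg_near_cst; apply: nearW => n; rewrite sE.
      rewrite (_ : test_fun (l n) x = 1) ?expr1n//.
      rewrite /test_fun big_seq; apply: big1 => p /lgood/asboolP gp.
      apply/eqP; rewrite eq_le; have /andP[_ ->] := cobump01 p x.
      by rewrite leNgt; apply/negP => /gp.
    rewrite indicE memNset//.
    have [p [px pO]] := cobump_base (closed_openC cC) nCx.
    have gp : good p by apply/asboolP.
    have /andP[c0 c1] := cobump01 p x.
    apply: (@squeeze_cvgr _ _ _ _ (fun=> 0) (fun n => cobump p x ^+ n)).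
    - near=> n; rewrite sE.
      have pl : p \in l n.
        apply/flattenP; exists (idx (pickle p)).
          apply/mapP; exists (pickle p) => //; rewrite mem_iota add0n.
          by near: n; exact: nbhs_infty_gt.
        by rewrite /idx pickleK gp mem_head.
      have /andP[t0 _] := test_fun01 (l n) x.
      rewrite exprn_ge0//=; apply: lerXn2r; rewrite ?nnegrE//.
      by apply: (@prod01_le _ (l n) (fun p => cobump p x)) => // q; exact: cobump01.
    - exact: cvg_cst.
    - by apply: cvg_expr; rewrite ger0_norm.
  have lim (mu : probability T R) : \int[mu]_x test_fun (s n) x @[n --> \oo] --> \int[mu]_x \1_C x.
    apply: (Rintegral_cvg (M := 1)).
    - by move=> k; apply: continuous_torus_measurable; exact: test_fun_continuous.
    - exact: measurable_indic.
    - by move=> k x; have /andP[h0 h1] := test_fun01 (s k) x; rewrite ger0_norm.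
    - by apply: aeW => x; exact: cv.
  have RI (mu : probability T R) : (\int[mu]_x (\1_C x))%:E = mu C.
    by rewrite /Rintegral integral_indic// setIT fineK// fin_num_measure.
  rewrite -!RI; congr EFin; apply: (cvg_unique _ (lim m)) => //.
  rewrite /= (_ : (fun n => _) = (fun n => \int[m']_x test_fun (s n) x)); first exact: lim.
  by apply/funext => n; exact: mm'.
move=> A mA; apply: (@measure_unique _ R T (@open T) (fun=> setT) _ _ _ _ m m') => //.
- by move=> B C; exact: openI.
- by move=> i; exact: openT.
- by apply/seteqP; split => // x _; exists 0%N.
- move=> O oO; have mO : measurable O by exact: sub_sigma_algebra.
  have compl (mu : probability T R) : mu O = (1 - mu (~` O))%E.
    by rewrite -[in LHS](setCK O) probability_setC//; exact: measurableC.
  transitivity (1 - m (~` O))%E; first exact: compl.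
  rewrite closed_eq; last exact: open_closedC.
  exact/esym/compl.
- by move=> k; apply: (le_lt_trans (probability_le1 m measurableT)); rewrite ltry.
Unshelve. all: end_near. Qed.

End Separation.

(** * Limits of the terms of the equation *)

Section UniformConvergence.
Variables (R : realType) (d : nat).
Local Notation T := (torus R d).
Local Notation P := (probability T R).
Implicit Types (h k : T -> R) (hs ks : nat -> T -> R).

Definition ucvg hs h := forall e : R, 0 < e -> \forall n \near \oo, forall x, `|hs n x - h x| < e.

Lemma ucvg_cst h : ucvg (fun=> h) h.
Proof. by move=> e e0; apply: nearW => n x; rewrite subrr normr0. Qed.

Lemma ucvgD hs h ks k : ucvg hs h -> ucvg ks k ->
  ucvg (fun n x => hs n x + ks n x) (fun x => h x + k x).
Proof.
move=> hc kc e e0; have e2 : 0 < e / 2 by rewrite divr_gt0.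
near=> n => x.
have h1 : forall x, `|hs n x - h x| < e / 2 by near: n; exact: hc.
have h2 : forall x, `|ks n x - k x| < e / 2 by near: n; exact: kc.
rewrite opprD addrACA; apply: le_lt_trans (ler_normD _ _) _.
by have := h1 x; have := h2 x; lra.
Unshelve. all: end_near. Qed.

Lemma ucvgM hs h ks k : continuous h -> continuous k -> ucvg hs h -> ucvg ks k ->
  ucvg (fun n x => hs n x * ks n x) (fun x => h x * k x).
Proof.
move=> /continuous_torus_bounded[M M0 hM] /continuous_torus_bounded[N N0 kN] hc kc e e0.
pose dl := Num.min 1 (e / (M + N + 2)).
have dl0 : 0 < dl by rewrite lt_min ltr01 divr_gt0// !addr_gt0.
near=> n => x.
have h1 : forall x, `|hs n x - h x| < dl by near: n; exact: hc.
have h2 : forall x, `|ks n x - k x| < dl by near: n; exact: kc.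
have -> : hs n x * ks n x - h x * k x =
  (hs n x - h x) * (ks n x - k x) + (hs n x - h x) * k x + h x * (ks n x - k x) by ring.
have a1 : `|(hs n x - h x) * (ks n x - k x)| <= dl * 1.
  rewrite normrM ler_pM ?(ltW (h1 x))// (le_trans (ltW (h2 x)))// ge_min lexx//.
have a2 : `|(hs n x - h x) * k x| <= dl * N by rewrite normrM ler_pM ?(ltW (h1 x)).
have a3 : `|h x * (ks n x - k x)| <= M * dl by rewrite normrM ler_pM ?(ltW (h2 x)).
have a4 : dl * (M + N + 2) <= e by rewrite -ler_pdivlMr ?addr_gt0// ge_min lexx orbT.
apply: le_lt_trans (ler_normD _ _) _.
apply: le_lt_trans (lerD (ler_normD _ _) (lexx _)) _; lra.
Unshelve. all: end_near. Qed.

Lemma ucvgZ hs h (c : R) : continuous h -> ucvg hs h ->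
  ucvg (fun n x => c * hs n x) (fun x => c * h x).
Proof. by move=> ch; apply: ucvgM => //; [exact: cst_continuous|exact: ucvg_cst]. Qed.

Lemma ucvgB hs h ks k : ucvg hs h -> ucvg ks k ->
  ucvg (fun n x => hs n x - ks n x) (fun x => h x - k x).
Proof.
move=> hc kc; apply: ucvgD => // e /kc; apply: filterS => n H x.
by rewrite -opprD normrN.
Qed.

Lemma ucvg_sum (I : Type) (s : seq I) (hs : I -> nat -> T -> R) (h : I -> T -> R) :
  (forall i, ucvg (hs i) (h i)) ->
  ucvg (fun n x => \sum_(i <- s) hs i n x) (fun x => \sum_(i <- s) h i x).
Proof.
move=> H; elim: s => [|i s IH].
  by move=> e e0; apply: nearW => n x; rewrite !big_nil subrr normr0.
have := ucvgD (H i) IH.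
by move=> K e /K; apply: filterS => n + x; rewrite !big_cons => /(_ x).
Qed.

Lemma near_subseq (e : nat -> nat) (Q : nat -> Prop) : (forall i, (i <= e i)%N) ->
  (\forall n \near \oo, Q n) -> \forall k \near \oo, Q (e k).
Proof.
by move=> ke [N _ NQ]; exists N => // k /= Nk; apply: NQ; exact: leq_trans Nk (ke k).
Qed.

Lemma ucvg_subseq hs h (e : nat -> nat) : (forall i, (i <= e i)%N) ->
  ucvg hs h -> ucvg (fun i => hs (e i)) h.
Proof. by move=> ke hc ep /hc; exact: near_subseq. Qed.

Lemma finite_measure_ucvg (mu : {finite_measure set T -> \bar R}) hs h :
  (forall n, continuous (hs n)) -> continuous h -> ucvg hs h ->
  \int[mu]_x hs n x @[n --> \oo] --> \int[mu]_x h x.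
Proof.
move=> chs ch hc; have [M M0 hM] := continuous_torus_bounded ch.
apply/cvgrPdist_lt => e e0.
have V0 : 0 <= fine (mu setT) by rewrite fine_ge0.
pose dl := e / (fine (mu setT) + 1).
have dl0 : 0 < dl by rewrite divr_gt0// ltr_wpDl.
near=> n.
have h1 : forall x, `|hs n x - h x| < dl by near: n; exact: hc.
have I g : continuous g -> mu.-integrable setT (EFin \o g).
  move=> cg; have [N N0 gN] := continuous_torus_bounded cg.
  exact: bounded_integrable (continuous_torus_measurable cg) gN.
rewrite -RintegralB//; [|exact: I..].
have N : `|\int[mu]_x (h x - hs n x)| <= dl * fine (mu setT).
  apply: Rintegral_norm_le => [|x]; last by rewrite distrC ltW.
  by apply: measurable_funB; exact: continuous_torus_measurable.
apply: le_lt_trans N _.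
by rewrite /dl mulrAC ltr_pdivrMr ?ltr_wpDl// ltr_pM2l// ltrDl.
Unshelve. all: end_near. Qed.

Definition weak_cvg (m_ : nat -> P) (m : P) :=
  forall h, continuous h -> \int[m_ n]_x h x @[n --> \oo] --> \int[m]_x h x.

Lemma weak_ucvg (m_ : nat -> P) m hs h : weak_cvg m_ m ->
  (forall n, continuous (hs n)) -> continuous h -> ucvg hs h ->
  \int[m_ n]_x hs n x @[n --> \oo] --> \int[m]_x h x.
Proof.
move=> wc chs ch hc.
have c2 : \int[m_ n]_x hs n x - \int[m_ n]_x h x @[n --> \oo] --> (0 : R).
  apply/cvgrPdist_lt => e e0; near=> n.
  have h1 : forall x, `|hs n x - h x| < e / 2 by near: n; apply: hc; rewrite divr_gt0.
  have I g : continuous g -> (m_ n).-integrable setT (EFin \o g).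
    move=> cg; have [N N0 gN] := continuous_torus_bounded cg.
    exact: bounded_integrable (continuous_torus_measurable cg) gN.
  rewrite sub0r normrN -RintegralB//; [|exact: I..].
  have N : `|\int[m_ n]_x (hs n x - h x)| <= e / 2 * fine (m_ n setT).
    apply: Rintegral_norm_le => [|x]; last by rewrite ltW.
    by apply: measurable_funB; exact: continuous_torus_measurable.
  by apply: le_lt_trans N _; rewrite probability_setT mulr1; lra.
rewrite (_ : (fun n => \int[m_ n]_x hs n x) =
  (fun n => (\int[m_ n]_x hs n x - \int[m_ n]_x h x) + \int[m_ n]_x h x)); last first.
  by apply/funext => n; rewrite subrK.
by rewrite -[X in _ --> X]add0r; apply: cvgD; [exact: c2|exact: wc].
Unshelve. all: end_near. Qed.

Lemma charge_int_ucvg (nu : charge T R) hs h :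
  (forall n, continuous (hs n)) -> continuous h -> ucvg hs h ->
  charge_int nu (hs n) @[n --> \oo] --> charge_int nu h.
Proof. by move=> chs ch hc; apply: cvgB; exact: finite_measure_ucvg. Qed.

Lemma pair_sub_ucvg (m_ : nat -> P) m (nu : charge T R) hs h : weak_cvg m_ m ->
  (forall n, continuous (hs n)) -> continuous h -> ucvg hs h ->
  pair_sub (hs n) (m_ n) nu @[n --> \oo] --> pair_sub h m nu.
Proof.
by move=> wc chs ch hc; apply: cvgB; [exact: weak_ucvg|exact: charge_int_ucvg].
Qed.

End UniformConvergence.

(** * Continuity with respect to the Wasserstein distance *)

Section Wasserstein.
Variables (R : realType) (d : nat).
Local Notation T := (torus R d).
Local Notation P := (probability T R).

Lemma W1_refl (m : P) (e : R) : 0 < e -> (W1 m m < e%:E)%E.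
Proof.
move=> e0; apply: (@le_lt_trans _ _ (\int[m]_x (cst 0 x : R)%:E)%E); last first.
  by rewrite integral0 lte_fin.
apply: (@W1_le_integral _ _ _ _ m id id) => // x.
by rewrite tdist_refl.
Qed.

Lemma W1_same (m m' m1 : P) : same_measure m m' -> W1 m m1 = W1 m' m1.
Proof.
move=> mm'; rewrite /W1; congr (ereal_inf (_ @` _)).
apply/seteqP; split => g cg A mA; have [g1 g2] := cg A mA.
  by rewrite g1 g2; split => //; exact: mm'.
by rewrite g1 g2; split => //; apply/esym; exact: mm'.
Qed.

Lemma Rintegral_same (m m' : P) (h : T -> R) : same_measure m m' ->
  \int[m]_x h x = \int[m']_x h x.
Proof.
move=> mm'; rewrite /Rintegral; congr fine.
by apply: eq_measure_integral => A mA _; first [exact: mm'|exact: esym (mm' _ mA)].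
Qed.

Definition W1_cvg (m_ : nat -> P) (m : P) :=
  forall e : R, 0 < e -> \forall n \near \oo, (W1 m (m_ n) < e%:E)%E.

(** Both (x, m_n) and (x, m) are compared with the fixed pair (a, m), so only distances to m occur;
    compactness of the torus makes the estimate uniform in x. *)
Lemma continuousTP_ucvg (f_ : nat -> T -> P -> R) f (m_ : nat -> P) m :
  continuousTP f -> loc_unif_cvgTP f_ f -> W1_cvg m_ m ->
  ucvg (fun n x => f_ n x (m_ n)) (f^~ m).
Proof.
move=> cf fc mc e e0; apply: torus_near => a.
have e4 : 0 < e / 4 by rewrite divr_gt0.
have [d1 d10 D1] := fc (tproj a) m.
have [d2 d20 D2] := cf (tproj a) m _ e4.
near=> b n.
have t1 : tdist (tproj a) (tproj b) < d1 by near: b; exact: near_tdist.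
have t2 : tdist (tproj a) (tproj b) < d2 by near: b; exact: near_tdist.
have w1 : (W1 m (m_ n) < d1%:E)%E by near: n; exact: mc.
have w2 : (W1 m (m_ n) < d2%:E)%E by near: n; exact: mc.
have h1 : forall y m', tdist (tproj a) y < d1 -> (W1 m m' < d1%:E)%E ->
    `|f_ n y m' - f y m'| < e / 4 by near: n; exact: D1.
have := h1 _ _ t1 w1; have := D2 _ _ t2 w2; have := D2 _ _ t2 (W1_refl m d20).
set A := f_ n _ _; set B := f _ _; set C := f _ _; set D := f _ _ => k1 k2 k3.
have -> : A - B = (A - D) + (D - C) - (B - C) by ring.
apply: le_lt_trans (ler_normB _ _) _.
apply: le_lt_trans (lerD (ler_normD _ _) (lexx _)) _; lra.
Unshelve. all: end_near. Qed.

Lemma continuousTP_continuous (f : T -> P -> R) m : continuousTP f -> continuous (f^~ m).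
Proof.
move=> cf; apply: torus_continuous => a.
apply/(@cvgrPdist_lt _ _ _ (nbhs a) (nbhs_filter a)) => e e0.
have [dl dl0 D] := cf (tproj a) m _ e0.
near=> b; rewrite /= distrC; apply: D; last exact: W1_refl.
by near: b; exact: near_tdist.
Unshelve. all: end_near. Qed.

End Wasserstein.

(** * Uniform limits of the Hamiltonian terms *)

Section HamiltonianLimit.
Variables (R : realType) (d : nat).
Local Notation T := (torus R d).
Implicit Types (K H : T -> 'rV[R]_d -> R) (p : T -> 'rV[R]_d).

Lemma loc_unif_near n (hs : nat -> 'rV[R]_n -> R) h (z : 'rV[R]_n) :
  loc_unif_cvg hs h -> exists2 V : set 'rV[R]_n, nbhs z V & forall e : R, 0 < e ->
    \forall k \near \oo, forall y, V y -> `|hs k y - h y| < e.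
Proof.
move=> /(_ z)[V nV cv]; exists V => // e e0.
have N : nbhs (h : {uniform` V -> R}) [set g | forall y, V y -> `|g y - h y| < e].
  apply/uniform_nbhs; exists [set xy | ball xy.1 e xy.2]; split.
    exact: (entourage_ball R (PosNum e0)).
  by move=> g /= gV y /gV; rewrite /ball /= distrC.
exact: cv _ N.
Qed.

Lemma nbhs_row_mx (a q : 'rV[R]_d) (W : set 'rV[R]_(d + d)) : nbhs (row_mx a q) W ->
  exists2 dl : R, 0 < dl & forall b r : 'rV[R]_d, (forall i, `|a 0 i - b 0 i| < dl) ->
    (forall i, `|q 0 i - r 0 i| < dl) -> W (row_mx b r).
Proof.
move=> /nbhs_ballP[dl /= dl0 dlW]; exists dl => // b r ab qr.
apply: dlW; split => // i j; rewrite ord1 !mxE /ball /=.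
by case: (fintype.split j) => k.
Qed.

Lemma hliftE H b q : hlift H (row_mx b q) = H (tproj b) q.
Proof. by rewrite /hlift row_mxKl row_mxKr. Qed.

Lemma near_coord (a : 'rV[R]_d) (dl : R) : 0 < dl ->
  nbhs a [set b : 'rV[R]_d | forall i, `|a 0 i - b 0 i| < dl].
Proof.
move=> dl0; apply/nbhs_ballP; exists dl => // b [_ ab] i.
exact: ab.
Qed.

Lemma near_coords p (a : 'rV[R]_d) (dl : R) : 0 < dl ->
  (forall i, continuous (fun x => p x 0 i)) ->
  \forall b \near a, forall i, `|p (tproj a) 0 i - p (tproj b) 0 i| < dl.
Proof.
move=> dl0 cp; apply: (@filter_forall 'rV[R]_d 'I_d
  (fun i b => `|p (tproj a) 0 i - p (tproj b) 0 i| < dl) (nbhs a) (nbhs_filter a)) => i.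
have /tlift_continuous/(_ a) := cp i.
by move=> /(@cvgrPdist_lt _ _ _ (nbhs a) (nbhs_filter a))/(_ _ dl0).
Qed.

Lemma hlift_continuous K p : continuous (hlift K) ->
  (forall i, continuous (fun x => p x 0 i)) -> continuous (fun x => K x (p x)).
Proof.
move=> cK cp; apply: torus_continuous => a.
apply/(@cvgrPdist_lt _ _ _ (nbhs a) (nbhs_filter a)) => e e0.
have /(@cvgrPdist_lt _ _ _ (nbhs _) (nbhs_filter _))/(_ _ e0) := cK (row_mx a (p (tproj a))).
move=> /nbhs_row_mx[dl dl0 D].
near=> b; have := D b (p (tproj b)); rewrite /= !hliftE; apply.
  by near: b; exact: near_coord.
by near: b; exact: near_coords.
Unshelve. all: end_near. Qed.

(** For x near a and n large, (x, p x) and (x, ps n x) lie in one neighbourhood of (a, p a), so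
    local uniform convergence suffices although the momenta move with n. *)
Lemma hlift_ucvg (Ks : nat -> T -> 'rV[R]_d -> R) K (ps : nat -> T -> 'rV[R]_d) p :
  loc_unif_cvg (fun n => hlift (Ks n)) (hlift K) -> continuous (hlift K) ->
  (forall i, continuous (fun x => p x 0 i)) ->
  (forall i, ucvg (fun n x => ps n x 0 i) (fun x => p x 0 i)) ->
  ucvg (fun n x => Ks n x (ps n x)) (fun x => K x (p x)).
Proof.
move=> KK cK cp pp e e0; apply: torus_near => a.
pose z := row_mx a (p (tproj a)).
have e4 : 0 < e / 4 by rewrite divr_gt0.
have [V nV VP] := loc_unif_near z KK.
have /(@cvgrPdist_lt _ _ _ (nbhs z) (nbhs_filter z))/(_ _ e4) nK := cK z.
have [dl dl0 D] := nbhs_row_mx (filterI nV nK).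
have dl2 : 0 < dl / 2 by rewrite divr_gt0.
have npp : \forall n \near \oo, forall i x, `|ps n x 0 i - p x 0 i| < dl / 2.
  apply: (@filter_forall nat 'I_d (fun i n => forall x, `|ps n x 0 i - p x 0 i| < dl / 2)
    \oo _) => i.
  exact: pp.
near=> b n.
have h1 : forall i, `|a 0 i - b 0 i| < dl by near: b; exact: near_coord.
have h2 : forall i, `|p (tproj a) 0 i - p (tproj b) 0 i| < dl / 2 by near: b; exact: near_coords.
have h3 : forall i x, `|ps n x 0 i - p x 0 i| < dl / 2 by near: n.
have h4 : forall y, V y -> `|hlift (Ks n) y - hlift K y| < e / 4 by near: n; exact: VP.
have [v1 k1] : (V `&` [set t | `|hlift K z - hlift K t| < e / 4]) (row_mx b (p (tproj b))).
  by apply: D => // i; have := h2 i; lra.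
have [v2 k2] : (V `&` [set t | `|hlift K z - hlift K t| < e / 4]) (row_mx b (ps n (tproj b))).
  apply: D => // i.
  have -> : p (tproj a) 0 i - ps n (tproj b) 0 i =
    (p (tproj a) 0 i - p (tproj b) 0 i) - (ps n (tproj b) 0 i - p (tproj b) 0 i) by ring.
  by apply: le_lt_trans (ler_normB _ _) _; have := h2 i; have := h3 i (tproj b); lra.
have := h4 _ v2; move: k1 k2; rewrite /= !hliftE.
set A := K _ _; set B := K _ _; set C := K _ _; set E := Ks _ _ _ => k1 k2 k3.
have -> : E - B = (E - C) - (A - C) + (A - B) by ring.
apply: le_lt_trans (ler_normD _ _) _.
apply: le_lt_trans (lerD (ler_normB _ _) (lexx _)) _; lra.
Unshelve. all: end_near. Qed.

(** The link between C^1 convergence of the lifts, in all d + d variables, and convergence of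
    D_pH. *)
Lemma partial_hlift H (i : 'I_d) :
  partial (rshift d i) (hlift H) = hlift (fun x => partial i (H x)).
Proof.
apply/funext => z; rewrite /partial /derive /hlift.
congr (lim _); apply: (congr1 (fun f : R -> R => f @ 0^')).
apply/funext => h /=; congr (_ *: (H _ _ - _)).
  congr tproj; apply/rowP => j; rewrite !mxE (_ : (lshift d j == rshift d i) = false) ?andbF ?mulr0 ?add0r//.
  by apply/negbTE; rewrite eq_lrshift.
by apply/rowP => j; rewrite !mxE eq_rshift.
Qed.

End HamiltonianLimit.

(** * Convergence in C^2 *)

Section C2Norm.
Variables (R : realType) (d : nat).
Local Notation T := (torus R d).
Implicit Types (g h : T -> R).

Lemma supnorm_ub g x : (`|g x|%:E <= supnorm g)%E.
Proof. by apply: ereal_sup_ubound; exists x. Qed.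

Lemma supnorm_ge0 g : (0 <= supnorm g)%E.
Proof. by apply: le_trans (supnorm_ub g (tproj 0)); rewrite lee_fin. Qed.

Lemma sume_ub (F : 'I_d -> \bar R) i : (forall j, 0 <= F j)%E ->
  (F i <= \sum_(j < d) F j)%E.
Proof.
by move=> F0; rewrite (bigD1 i)//= leeDl//; apply: sume_ge0.
Qed.

Lemma adde3_ub (a b c : \bar R) : (0 <= a -> 0 <= b -> 0 <= c ->
  (a <= a + b + c) /\ (b <= a + b + c) /\ (c <= a + b + c))%E.
Proof.
move=> a0 b0 c0; split; last split.
- by rewrite -addeA leeDl// adde_ge0.
- by rewrite -addeA addeCA leeDl// adde_ge0.
- by rewrite leeDr// adde_ge0.
Qed.

Lemma c2norm_ub g x : ((`|g x|%:E <= c2norm g) /\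
  (forall i, `|tpartial i g x|%:E <= c2norm g) /\
  (forall i j, `|tpartial i (tpartial j g) x|%:E <= c2norm g))%E.
Proof.
have s2' k : (0 <= \sum_(j < d) supnorm (tpartial k (tpartial j g)))%E.
  by apply: sume_ge0 => l _; exact: supnorm_ge0.
have [||n1 [n2 n3]] := @adde3_ub (supnorm g) (\sum_(i < d) supnorm (tpartial i g))%E
  (\sum_(i < d) \sum_(j < d) supnorm (tpartial i (tpartial j g)))%E (supnorm_ge0 g).
- by apply: sume_ge0 => k _; exact: supnorm_ge0.
- by apply: sume_ge0 => k _; exact: s2'.
split; first exact: le_trans (supnorm_ub g x) n1.
split=> [i|i j].
  apply: le_trans n2; apply: le_trans (supnorm_ub _ x) _.
  by apply: (sume_ub (F := fun i => supnorm (tpartial i g))) => k; exact: supnorm_ge0.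
apply: le_trans n3; apply: le_trans (supnorm_ub _ x) _.
apply: (@le_trans _ _ (\sum_(j < d) supnorm (tpartial i (tpartial j g)))%E).
  by apply: (sume_ub (F := fun j => supnorm (tpartial i (tpartial j g)))) => k; exact: supnorm_ge0.
by apply: (sume_ub (F := fun i => (\sum_(j < d) supnorm (tpartial i (tpartial j g)))%E)) => k.
Qed.

Lemma tpartial_sub i g h : Ck 1 (tlift g) -> Ck 1 (tlift h) ->
  tpartial i (fun x => g x - h x) = (fun x => tpartial i g x - tpartial i h x).
Proof.
move=> cg ch; apply/funext => x; apply: partial_val.
exact: (is_deriveB (Ck_is_derive i (repr x) cg) (Ck_is_derive i (repr x) ch)).
Qed.

Lemma tpartial_Ck k i g : Ck k.+1 (tlift g) -> Ck k (tlift (tpartial i g)).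
Proof. by move=> [_ /(_ i)[_ ck]]; rewrite tlift_partial. Qed.

Lemma tC2_continuous g : tC2 g -> [/\ continuous g,
  forall i, continuous (tpartial i g) & forall i j, continuous (tpartial i (tpartial j g))].
Proof.
move=> cg; split=> [|i|i j]; apply/tlift_continuous.
- exact: Ck_continuous cg.
- by apply: (@Ck_continuous _ _ 1); apply: tpartial_Ck; exact: cg.
- by apply: (@Ck_continuous _ _ 0); do 2 apply: tpartial_Ck; exact: cg.
Qed.

Lemma tC2_sub g h : tC2 g -> tC2 h -> tC2 (fun x => g x - h x).
Proof. exact: Ck_sub. Qed.

Lemma tlaplacian_continuous g : tC2 g -> continuous (tlaplacian g).
Proof.
move=> /tC2_continuous[_ _ c].
apply: (@continuous_big _ _ _ _ _ _ _ _ (fun i x => tpartial i (tpartial i g) x)).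
  exact: add_continuous.
by move=> i _; exact: c.
Qed.

Definition c2cvg (us : nat -> T -> R) (u : T -> R) := [/\ ucvg us u,
  forall i, ucvg (fun n => tpartial i (us n)) (tpartial i u) &
  forall i j, ucvg (fun n => tpartial i (tpartial j (us n))) (tpartial i (tpartial j u))].

(** The middle sequence is meant to be U(., m_n): close to U_n(., m_n) by convergence in B, and
    converging to U(., m_0) because U is in B^c. *)
Lemma c2norm_c2cvg (us vs : nat -> T -> R) (u : T -> R) : (forall n, tC2 (us n)) ->
  (forall n, tC2 (vs n)) -> tC2 u ->
  (forall e : R, 0 < e -> \forall n \near \oo, (c2norm (fun x => us n x - vs n x)%R < e%:E)%E) ->
  (forall e : R, 0 < e -> \forall n \near \oo, (c2norm (fun x => vs n x - u x)%R < e%:E)%E) ->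
  c2cvg us u.
Proof.
move=> cus cvs cu h1 h2.
have key (D : (T -> R) -> T -> R) :
    (forall n, D (fun x => us n x - vs n x) = (fun x => D (us n) x - D (vs n) x)) ->
    (forall n, D (fun x => vs n x - u x) = (fun x => D (vs n) x - D u x)) ->
    (forall g x, (`|D g x|%:E <= c2norm g)%E) -> ucvg (fun n => D (us n)) (D u).
  move=> D1 D2 Db e e0; have e2 : 0 < e / 2 by rewrite divr_gt0.
  apply: filterS2 (h1 _ e2) (h2 _ e2) => n n1 n2 x.
  have := le_lt_trans (Db _ x) n1; have := le_lt_trans (Db _ x) n2.
  rewrite D1 D2 !lte_fin => k1 k2.
  have -> : D (us n) x - D u x = (D (us n) x - D (vs n) x) + (D (vs n) x - D u x) by ring.
  by apply: le_lt_trans (ler_normD _ _) _; lra.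
have c1 g : tC2 g -> Ck 1 (tlift g) by exact: CkW.
have c2 k g : tC2 g -> Ck 1 (tlift (tpartial k g)) by move=> cg; apply: tpartial_Ck; exact: cg.
split=> [|i|i j].
- by apply: (key id) => // g x; exact: (c2norm_ub g x).1.
- apply: (key (tpartial i)).
  + move=> n; exact: (tpartial_sub i (c1 _ (cus n)) (c1 _ (cvs n))).
  + move=> n; exact: (tpartial_sub i (c1 _ (cvs n)) (c1 _ cu)).
  + move=> g x; exact: ((c2norm_ub g x).2.1 i).
- apply: (key (fun g => tpartial i (tpartial j g))).
  + move=> n; rewrite (tpartial_sub j (c1 _ (cus n)) (c1 _ (cvs n))).
    exact: (tpartial_sub i (c2 j _ (cus n)) (c2 j _ (cvs n))).
  + move=> n; rewrite (tpartial_sub j (c1 _ (cvs n)) (c1 _ cu)).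
    exact: (tpartial_sub i (c2 j _ (cvs n)) (c2 j _ cu)).
  + move=> g x; exact: ((c2norm_ub g x).2.2 i j).
Qed.

End C2Norm.

(** * Strict minima and the limit *)

Section StrictMinimum.
Variables (R : realType) (d : nat).
Local Notation T := (torus R d).
Local Notation P := (probability T R).
Implicit Types (V : T -> P -> R) (phi psi : T -> R) (nu : charge T R).

Lemma Ck_bound_le n k (h : 'rV[R]_n -> R) (M M' : R) : M <= M' -> Ck_bound k h M -> Ck_bound k h M'.
Proof.
move=> MM'; elim: k h => [|k IH] h [hM H].
  by split => // x; exact: le_trans (hM x) MM'.
by split => [x|i]; [exact: le_trans (hM x) MM'|exact: IH (H i)].
Qed.

Lemma Ck_bound_scale n k (c : R) (h : 'rV[R]_n -> R) (M : R) : Ck k h -> Ck_bound k h M ->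
  Ck_bound k (fun x => c * h x) (`|c| * M).
Proof.
elim: k h => [|k IH] h ch [hM H].
  by split => // x; rewrite normrM ler_wpM2l.
split => [x|i]; first by rewrite normrM ler_wpM2l.
rewrite (_ : partial i (fun x => c * h x) = (fun x => c * partial i h x)).
  by apply: IH; [exact: (ch.2 i).2|exact: H].
apply/funext => x; apply: partial_val.
exact: (is_deriveZ c (Ck_is_derive i x ch)).
Qed.

Lemma torus_Ck_bound k (g : T -> R) : Ck k (tlift g) -> exists2 M : R, 0 < M & Ck_bound k (tlift g) M.
Proof.
elim: k g => [|k IH] g cg.
  have [M M0 gM] := continuous_torus_bounded ((tlift_continuous g).1 (Ck_continuous cg)).
  by exists M => //; split => // x; exact: gM.
have [M M0 gM] := continuous_torus_bounded ((tlift_continuous g).1 (Ck_continuous cg)).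
have H (i : 'I_d) : exists N : R, 0 < N /\ Ck_bound k (partial i (tlift g)) N.
  by have [N N0 gN] := IH _ (tpartial_Ck i cg); exists N; rewrite -tlift_partial.
have [N NP] := choice H.
have N0 : 0 <= \sum_i N i by apply: sumr_ge0 => i _; exact: ltW (NP i).1.
exists (M + \sum_i N i); first by rewrite ltr_wpDr.
split => [x|i]; first by apply: le_trans (gM _) _; rewrite lerDl.
apply: Ck_bound_le (NP i).2; rewrite (bigD1 i)//=.
rewrite addrCA lerDl addr_ge0 ?(ltW M0)//; apply: sumr_ge0 => j _; exact: ltW (NP j).1.
Qed.

Lemma continuous_integrable (mu : {finite_measure set T -> \bar R}) (g : T -> R) :
  continuous g -> mu.-integrable setT (EFin \o g).
Proof.
move=> cg; have [N N0 gN] := continuous_torus_bounded cg.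
exact: bounded_integrable (continuous_torus_measurable cg) gN.
Qed.

Lemma pair_subD (f g : T -> R) m nu : continuous f -> continuous g ->
  pair_sub (fun x => f x + g x) m nu = pair_sub f m nu + pair_sub g m nu.
Proof.
move=> cf cg; rewrite /pair_sub /charge_int !RintegralD//; try exact: continuous_integrable.
ring.
Qed.

Lemma loc_unif_cvgTP_cst V : loc_unif_cvgTP (fun=> V) V.
Proof.
move=> x m; exists 1 => // e e0; apply: nearW => n y m' _ _.
by rewrite subrr normr0.
Qed.

Lemma pair_sub_continuous V phi nu (ms : nat -> P) m : inB V -> continuous phi ->
  W1_cvg ms m -> weak_cvg ms m ->
  pair_sub (fun x => V x (ms n) - phi x) (ms n) nu @[n --> \oo] -->
    pair_sub (fun x => V x m - phi x) m nu.
Proof.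
move=> [cV _ _] cphi mW mw; apply: pair_sub_ucvg => //.
- by move=> n x; apply: continuousB; [exact: continuousTP_continuous|exact: cphi].
- by move=> x; apply: continuousB; [exact: continuousTP_continuous|exact: cphi].
- apply: ucvgB; last exact: ucvg_cst.
  by apply: (continuousTP_ucvg (f_ := fun=> V)) => //; exact: loc_unif_cvgTP_cst.
Qed.

(** The direct method: a minimizing sequence has a limit along [e] by [prob_compact]. The infimum,
    taken in the extended reals, is finite because it is the value at that limit; m0 makes the set
    of values nonempty. *)
Lemma exists_argmin (d0 : (0 < d)%N) (m0 : P) (L : P -> R) :
  (forall (ms : nat -> P) m, W1_cvg ms m -> weak_cvg ms m -> L (ms n) @[n --> \oo] --> L m) ->
  exists m, forall m', L m <= L m'.
Proof.
move=> cL; pose S := [set (L m)%:E | m in [set: P]].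
have S0 : S != set0 by apply/set0P; exists (L m0)%:E; exists m0.
have [u Su cu] := ereal_inf_seq S0.
have [ms msP] : exists ms : nat -> P, forall n, (L (ms n))%:E = u n.
  have H n : exists m : P, (L m)%:E = u n by have [m _ <-] := Su n; exists m.
  by have [ms msP] := choice H; exists ms.
have [e [ke [m [mW mw]]]] := prob_compact d0 ms.
exists m => m'.
have c1 : L (ms (e n)) @[n --> \oo] --> L m by exact: cL.
have c2 : (u (e n)) @[n --> \oo] --> ereal_inf S.
  apply: cvg_trans cu; move=> B [N _ NB]; exists N => // n /= Nn.
  by apply: NB; exact: leq_trans Nn (ke n).
have c3 : (u (e n)) @[n --> \oo] --> (L m)%:E.
  under eq_cvg do rewrite -msP.
  by apply/fine_cvgP; split; [exact: nearW|exact: c1].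
rewrite -lee_fin (cvg_unique _ c3 c2)//.
by apply: ereal_inf_lbound; exists m'.
Qed.

Lemma perturb_strict_min (d0 : (0 < d)%N) V phi nu (eps : R) (m0 : P) : inB V -> tC2 phi ->
  0 < eps -> exists psi, [/\ tC2 psi, Ck_bound 2 (tlift psi) eps &
    exists m1, strict_min (fun m => pair_sub (fun x => V x m - (phi x - psi x)) m nu) m1].
Proof.
move=> BV cphi eps0.
pose idx (j : nat) := test_fun (odflt [::] (unpickle j)) : T -> R.
have c2idx j : tC2 (idx j) by exact: tC2_test_fun.
have /choice[M MP] : forall j, exists M : R, 0 < M /\ Ck_bound 2 (tlift (idx j)) M.
  by move=> j; have [M M0 H] := torus_Ck_bound (c2idx j); exists M.
(* Normalized in C^2: the functionals [g j] are then bounded by 1, and the geometric decay of the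
   coefficients bounds psi in C^2. *)
pose G j x := (M j)^-1 * idx j x.
have cG j : tC2 (G j) by apply: (@Ck_scale _ _ 2); exact: c2idx.
have bG j : Ck_bound 2 (tlift (G j)) 1.
  have := Ck_bound_scale (M j)^-1 (c2idx j) (MP j).2.
  by rewrite gtr0_norm ?invr_gt0 ?(MP j).1// mulVf ?gt_eqF ?(MP j).1.
have contG j : continuous (G j) by exact/tlift_continuous/(Ck_continuous (cG j)).
pose g j (m : P) := \int[m]_x G j x.
have g1 j m : `|g j m| <= 1.
  have /(_ _ _)/le_trans := @Rintegral_norm_le _ T R m (G j) 1.
  apply; first exact: continuous_torus_measurable.
    by move=> x; have := (bG j).1 (repr x); rewrite /tlift tproj_repr.
  have V1 : fine (m setT) = 1 by rewrite probability_setT.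
  by rewrite mul1r le_eqVlt; apply/orP; left; apply/eqP; exact: V1.
pose J m := pair_sub (fun x => V x m - phi x) m nu.
(* Half of [eps], because summing the series doubles the bound on its coefficients. *)
have e2 : 0 < eps / 2 by rewrite divr_gt0.
have [t [tb tuniq]] := perturb_unique_argmin J g1 e2.
pose H (j : nat) x := t j * G (logn 2 j.+1) x.
pose psi : T -> R := fun_series H.
have [cpsi bpsi] : Ck 2 (tlift psi) /\ Ck_bound 2 (tlift psi) (2 * (eps / 2)).
  apply: (@Ck_series _ _ 2 (fun j => tlift (H j)) (eps / 2)) => j.
    by apply: (@Ck_scale _ _ 2); exact: cG.
  apply: Ck_bound_le (Ck_bound_scale (t j) (cG _) (bG _)).
  by rewrite mulr1.
have {}bpsi : Ck_bound 2 (tlift psi) eps.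
  by apply: Ck_bound_le bpsi; rewrite mulrC divfK.
have contpsi : continuous psi by exact/tlift_continuous/(Ck_continuous cpsi).
pose L m := J m + \int[m]_x psi x.
have contphi : continuous phi by have [] := tC2_continuous cphi.
exists psi; split => //.
have contH j : continuous (H j).
  by move=> x; apply: continuousM; [exact: cst_continuous|exact: contG].
have HB j x : `|H j x| <= (eps / 2) / 2 ^+ j.
  rewrite normrM -[leRHS]mulr1 ler_pM//.
  by have := (bG (logn 2 j.+1)).1 (repr x); rewrite /tlift tproj_repr.
have Lcv m : J m + \sum_(0 <= j < n) t j * g (logn 2 j.+1) m @[n --> \oo] --> L m.
  apply: cvgD; first exact: cvg_cst.
  have contS n : continuous (fun x => series (H ^~ x) n).
    rewrite /series /=; apply: (@continuous_big _ _ _ _ _ _ _ _ (fun j y => H j y)).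
      exact: add_continuous.
    by move=> j _; exact: contH.
  rewrite (_ : (fun n => _) = (fun n => \int[m]_x series (H ^~ x) n)).
    apply: finite_measure_ucvg => // e e0.
    have [N Ne] := geometric_small (2 * (eps / 2)) e0.
    near=> n => x; rewrite distrC; apply: le_lt_trans Ne.
    apply: le_trans ((cvg_geometric_bound (fun j => HB j x)).2 n) _.
    rewrite ler_pM2l ?mulr_gt0// lef_pV2 ?posrE ?exprn_gt0// ler_weXn2l ?ler1n//.
    by near: n; exact: nbhs_infty_ge.
  apply/funext; elim=> [|n IH].
    by rewrite big_geq// (_ : (fun x => _) = cst 0) ?Rintegral_cst ?mul0r//;
      apply/funext => x; rewrite /series /= big_geq.
  rewrite big_nat_recr//= IH (_ : (fun x => series (H ^~ x) n.+1) =
    (fun x => series (H ^~ x) n + H n x)); last by apply/funext => x; rewrite seriesSr.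
  rewrite RintegralD//; [|exact: continuous_integrable..].
  by congr (_ + _); rewrite /g /H RintegralZl//; exact: continuous_integrable.
have Lcont (ms : nat -> P) m : W1_cvg ms m -> weak_cvg ms m -> L (ms n) @[n --> \oo] --> L m.
  by move=> mW mw; apply: cvgD; [exact: pair_sub_continuous|exact: mw].
have [m1 m1P] := exists_argmin d0 m0 Lcont.
exists m1 => m nm.
(* Replacing phi by phi - psi adds <psi, m> to the functional up to a constant depending on nu, so
   the minimizers are those of L. *)
have LE m' : pair_sub (fun x => V x m' - (phi x - psi x)) m' nu = L m' - charge_int nu psi.
  rewrite (_ : (fun x => _) = (fun x => (V x m' - phi x) + psi x)); last first.
    by apply/funext => x; ring.
  rewrite pair_subD//; first by rewrite /L /J /pair_sub; ring.
  move=> x; apply: continuousB; last exact: contphi.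
  by apply: continuousTP_continuous; case: BV.
rewrite !LE ltrD2r ltNge; apply/negP => mm1; apply: nm.
apply: test_fun_separating => s.
have am1 : near_argmin L 0 m1 by move=> z /=; rewrite addr0.
have am : near_argmin L 0 m by move=> z /=; rewrite addr0 (le_trans mm1).
(* Two minimizers of L give every test function the same integral, hence are the same measure. *)
have := tuniq L Lcv m m1 am am1 (pickle s).
rewrite /g /G /idx pickleK /= !RintegralZl//; try exact/continuous_integrable/test_fun_continuous.
by apply: mulfI; rewrite invr_eq0 gt_eqF// (MP _).1.
Unshelve. all: end_near. Qed.

End StrictMinimum.

(** * Passage to the limit in the inequality *)

Section Main.
Variables (R : realType) (d : nat).
Local Notation T := (torus R d).
Local Notation P := (probability T R).

Lemma inB_tC2 (V : T -> P -> R) m : inB V -> tC2 (V^~ m).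
Proof. by case. Qed.

Lemma Bnorm_near (Us : nat -> T -> P -> R) U (e : R) : Bcvg Us U -> 0 < e ->
  \forall n \near \oo, forall m, (c2norm (fun x => Us n x m - U x m)%R < e%:E)%E.
Proof.
move=> cU e0.
have N : nbhs 0%E [set y : \bar R | (y < e%:E)%E].
  by apply: open_nbhs_nbhs; split; [exact: open_ereal_lt_ereal|rewrite /= lte_fin].
have H : \forall n \near \oo, (Bnorm (fun x m => Us n x m - U x m)%R < e%:E)%E := cU _ N.
apply: filterS H => n H m; apply: le_lt_trans H.
by apply: ereal_sup_ubound; exists m.
Qed.

Lemma dotv_ucvg (ps qs : nat -> T -> 'rV[R]_d) (p q : T -> 'rV[R]_d) :
  (forall i, continuous (fun x => p x 0 i)) -> (forall i, continuous (fun x => q x 0 i)) ->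
  (forall i, ucvg (fun n x => ps n x 0 i) (fun x => p x 0 i)) ->
  (forall i, ucvg (fun n x => qs n x 0 i) (fun x => q x 0 i)) ->
  ucvg (fun n x => dotv (ps n x) (qs n x)) (fun x => dotv (p x) (q x)).
Proof. by move=> cp cq pp qq; apply: ucvg_sum => i; exact: ucvgM. Qed.

Lemma dotv_continuous (p q : T -> 'rV[R]_d) :
  (forall i, continuous (fun x => p x 0 i)) -> (forall i, continuous (fun x => q x 0 i)) ->
  continuous (fun x => dotv (p x) (q x)).
Proof.
move=> cp cq; apply: (@continuous_big _ _ _ _ _ _ _ _ (fun i x => p x 0 i * q x 0 i)).
  exact: add_continuous.
by move=> i _ x; apply: continuousM; [exact: cp|exact: cq].
Qed.

Lemma affine_continuous (c : R) (g h : T -> R) : continuous g -> continuous h ->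
  continuous (fun x => c * g x + h x).
Proof.
move=> cg ch x; apply: (@continuousD _ _ T (fun x => c * g x) h); last exact: ch.
by apply: (@continuousM _ T (fun=> c) g); [exact: cst_continuous|exact: cg].
Qed.

Lemma tgrad_coord (g : T -> R) (i : 'I_d) : (fun x => tgrad g x 0 i) = tpartial i g.
Proof. by apply/funext => x; rewrite mxE. Qed.

Lemma tlaplacian_ucvg (us : nat -> T -> R) u : c2cvg us u ->
  ucvg (fun n => tlaplacian (us n)) (tlaplacian u).
Proof. by move=> [_ _ H]; apply: ucvg_sum => i; exact: H. Qed.

Lemma Ck_bound_c2cvg0 (psis : nat -> T -> R) :
  (forall n, Ck_bound 2 (tlift (psis n)) n.+1%:R^-1) -> c2cvg psis (cst 0).
Proof.
move=> B; have p0 (i : 'I_d) : tpartial i (cst 0) = cst 0.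
  by apply/funext => x; apply: partial_val; exact: is_derive_cst.
have H (D : (T -> R) -> T -> R) : D (cst 0) = cst 0 ->
    (forall n x, `|D (psis n) x| <= n.+1%:R^-1) -> ucvg (fun n => D (psis n)) (D (cst 0)).
  move=> -> DB e e0; near=> n => x; rewrite subr0; apply: le_lt_trans (DB n x) _.
  by near: n; exact: (near_infty_natSinv_lt (PosNum e0)).
have L (g : T -> R) x : g x = tlift g (repr x) by rewrite /tlift tproj_repr.
split=> [|i|i j].
- by apply: (H id) => // n x; rewrite L; exact: (B n).1.
- apply: (H (tpartial i)) => // n x; rewrite L tlift_partial.
  exact: ((B n).2 i).1.
- apply: (H (fun g => tpartial i (tpartial j g))); first by rewrite p0 p0.
  move=> n x; rewrite L tlift_partial tlift_partial.
  exact: (((B n).2 j).2 i).1.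
Unshelve. all: end_near. Qed.

Lemma c2cvg_sub (us vs : nat -> T -> R) u v : (forall n, tC2 (us n)) -> (forall n, tC2 (vs n)) ->
  tC2 u -> tC2 v -> c2cvg us u -> c2cvg vs v ->
  c2cvg (fun n x => us n x - vs n x) (fun x => u x - v x).
Proof.
have c1 (g : T -> R) : tC2 g -> Ck 1 (tlift g) by exact: CkW.
have c2 k (g : T -> R) : tC2 g -> Ck 1 (tlift (tpartial k g)).
  by move=> cg; apply: tpartial_Ck; exact: cg.
move=> cus cvs cu cv [u1 u2 u3] [v1 v2 v3]; split=> [|i|i j].
- exact: ucvgB.
- rewrite (tpartial_sub i (c1 _ cu) (c1 _ cv)).
  rewrite (_ : (fun n => _) = (fun n x => tpartial i (us n) x - tpartial i (vs n) x)).
    exact: ucvgB.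
  by apply/funext => n; exact: (tpartial_sub i (c1 _ (cus n)) (c1 _ (cvs n))).
- rewrite (tpartial_sub j (c1 _ cu) (c1 _ cv)) (tpartial_sub i (c2 j _ cu) (c2 j _ cv)).
  rewrite (_ : (fun n => _) = (fun n x => tpartial i (tpartial j (us n)) x -
    tpartial i (tpartial j (vs n)) x)); first exact: ucvgB.
  apply/funext => n; rewrite (tpartial_sub j (c1 _ (cus n)) (c1 _ (cvs n))).
  exact: (tpartial_sub i (c2 j _ (cus n)) (c2 j _ (cvs n))).
Qed.

Lemma C1_gradp_cvg (Hs : nat -> T -> 'rV[R]_d -> R) H (i : 'I_d) :
  C1_loc_unif_cvg (fun n => hlift (Hs n)) (hlift H) ->
  loc_unif_cvg (fun n => hlift (fun x => partial i (Hs n x))) (hlift (fun x => partial i (H x))).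
Proof.
move=> [_ /(_ (rshift d i))]; rewrite partial_hlift.
by under eq_fun do rewrite partial_hlift.
Qed.

Lemma C1_gradp_continuous (H : T -> 'rV[R]_d -> R) (i : 'I_d) : Ck 1 (hlift H) ->
  continuous (hlift (fun x => partial i (H x))).
Proof. by move=> [_ /(_ (rshift d i))[_ [c _]]]; rewrite -partial_hlift. Qed.

Lemma loc_unif_subseq n (hs : nat -> 'rV[R]_n -> R) (h : 'rV[R]_n -> R) (e : nat -> nat) :
  (forall k, (k <= e k)%N) -> loc_unif_cvg hs h -> loc_unif_cvg (fun k => hs (e k)) h.
Proof.
move=> ke H x; have [V nV cv] := H x; exists V => // B nB.
have [N _ NB] := cv B nB.
by exists N => // k /= Nk; apply: NB; exact: leq_trans Nk (ke k).
Qed.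

(** Two representations of one measure are at Wasserstein distance below every positive number, so
    continuity identifies the values. *)
Lemma continuousTP_same (V : T -> P -> R) (m m' : P) x : continuousTP V ->
  same_measure m m' -> V x m = V x m'.
Proof.
move=> cV mm'; apply/eqP; rewrite -subr_eq0 -normr_le0 leNgt; apply/negP => h.
have [dl dl0 D] := cV x m _ h.
suff : `|V x m' - V x m| < `|V x m - V x m'| by rewrite distrC ltxx.
by apply: D; [rewrite tdist_refl|rewrite (W1_same _ mm'); exact: W1_refl].
Qed.

End Main.

Theorem proposition3p2 (R : realType) (d : nat) (hd : (1 < d)%N)
    (r sigma : R) (hr : 0 < r) (hsigma : 0 < sigma)
    (H_ : nat -> torus R d -> 'rV[R]_d -> R) (H : torus R d -> 'rV[R]_d -> R)
    (f_ : nat -> torus R d -> probability (torus R d) R -> R)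
    (f : torus R d -> probability (torus R d) R -> R)
    (U_ : nat -> torus R d -> probability (torus R d) R -> R)
    (U : torus R d -> probability (torus R d) R -> R)
    (hH_ : forall n, Ck 1 (hlift (H_ n))) (hH : Ck 1 (hlift H))
    (hf_ : forall n, continuousTP (f_ n)) (hf : continuousTP f)
    (H_cvg : C1_loc_unif_cvg (fun n => hlift (H_ n)) (hlift H))
    (f_cvg : loc_unif_cvgTP f_ f)
    (U_sol : forall n, monotone_solution r sigma (H_ n) (f_ n) (U_ n))
    (hU : inBc U) (U_cvg : Bcvg U_ U) :
  monotone_solution r sigma H f U.
Proof.
have [BU cU] := hU; split; first exact: BU.
move=> phi nu m0 cphi min0; cbv zeta.
set u := U^~ m0; pose b x := gradp H x (tgrad u x); pose w x := u x - phi x.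
have d0 : (0 < d)%N by exact: ltnW.
have BU_ n : inB (U_ n) by case: (U_sol n).
have tU mm : tC2 (U^~ mm) := inB_tC2 mm BU.
have tU_ n mm : tC2 (U_ n ^~ mm) := inB_tC2 mm (BU_ n).
(* The size 1/(n + 1) makes the perturbations tend to 0 in C^2, so the test functions phi - psi_n
   tend to phi. *)
have sol n : exists s : (torus R d -> R) * probability (torus R d) R,
    [/\ tC2 s.1, Ck_bound 2 (tlift s.1) n.+1%:R^-1 &
     strict_min (fun m => pair_sub (fun x => U_ n x m - (phi x - s.1 x)) m nu) s.2].
  have n0 : 0 < n.+1%:R^-1 :> R by rewrite invr_gt0.
  have [psi [c1 c2 [m1 c3]]] := perturb_strict_min d0 nu m0 (BU_ n) cphi n0.
  by exists (psi, m1).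
have [s sP] := choice sol.
pose psi n := (s n).1; pose m n := (s n).2.
have cpsi n : tC2 (psi n) by have [] := sP n.
have bpsi n : Ck_bound 2 (tlift (psi n)) n.+1%:R^-1 by have [] := sP n.
have minm n : strict_min (fun m => pair_sub (fun x => U_ n x m - (phi x - psi n x)) m nu) (m n).
  by have [] := sP n.
have [e [ke [ms [mW mw]]]] := prob_compact d0 m.
have [cphi0 _ _] := tC2_continuous cphi.
have phi_c2 : c2cvg (fun n x => phi x - psi n x) (fun x => phi x - cst 0 x).
  have c0 : tC2 (cst 0 : torus R d -> R) by exact: Ck_cst.
  have cc : c2cvg (fun=> phi) phi by split=> [|i|i j]; exact: ucvg_cst.
  exact: (c2cvg_sub (us := fun=> phi) (fun=> cphi) cpsi cphi c0 cc (Ck_bound_c2cvg0 bpsi)).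
have phi0 : (fun x => phi x - cst 0 x) = phi by apply/funext => x; rewrite subr0.
rewrite phi0 in phi_c2.
have cUm k : tC2 (U_ (e k) ^~ (m (e k))) := tU_ _ _.
have U_near (x0 : R) : 0 < x0 -> \forall k \near \oo, forall m',
    (c2norm (fun x => U_ (e k) x m' - U x m')%R < x0%:E)%E.
  by move=> x00; have := Bnorm_near U_cvg x00; exact: near_subseq.
(* Membership of U in B^c enters here. The limit is a parameter because the statement is applied to
   the extracted limit [ms] and then, once they are identified, to m0. *)
have u_c2 (mm : probability (torus R d) R) : W1_cvg (m \o e) mm ->
    c2cvg (fun k x => U_ (e k) x (m (e k))) (U^~ mm).
  move=> mmW; apply: (@c2norm_c2cvg _ _ _ (fun k x => U x (m (e k)))).
  - exact: cUm.
  - by move=> k; exact: tU.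
  - exact: tU.
  - by move=> x0 /U_near; apply: filterS => k; exact.
  - move=> x0 x00; have [dl dl0 D] := cU mm _ x00.
    by apply: filterS (mmW _ dl0) => k; exact: D.
have phi_c2e : c2cvg (fun k x => phi x - psi (e k) x) phi.
  have [p1 p2 p3] := phi_c2; split=> [|i|i j].
  - exact: (ucvg_subseq ke p1).
  - exact: (ucvg_subseq ke (p2 i)).
  - exact: (ucvg_subseq ke (p3 i j)).
have cphipsi n : tC2 (fun x => phi x - psi n x) := tC2_sub cphi (cpsi n).
have w_c2 (mm : probability (torus R d) R) : W1_cvg (m \o e) mm ->
    c2cvg (fun k x => U_ (e k) x (m (e k)) - (phi x - psi (e k) x)) (fun x => U x mm - phi x).
  move=> mmW; exact: (c2cvg_sub cUm (fun k => cphipsi (e k)) (tU mm) cphi (u_c2 mm mmW) phi_c2e).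
have cw k : tC2 (fun x => U_ (e k) x (m (e k)) - (phi x - psi (e k) x)) 
  := tC2_sub (cUm k) (cphipsi _).
have cont (g : torus R d -> R) : tC2 g -> continuous g by move=> /tC2_continuous[].
have cUphi mm : tC2 (fun x => U x mm - phi x) 
  := tC2_sub (tU mm) cphi.
(* Otherwise strictness at m0 would contradict the limit of the inequalities between the values of
   the perturbed functionals at their minima and at m0. *)
have same0 : same_measure ms m0.
  apply: contrapT => /min0; apply/negP; rewrite -leNgt.
  have l1 : pair_sub (fun x => U_ (e k) x (m (e k)) - (phi x - psi (e k) x)) (m (e k)) nu
      @[k --> \oo] --> pair_sub (fun x => U x ms - phi x) ms nu.
    have [w1 _ _] := w_c2 ms mW.
    refine (pair_sub_ucvg mw _ (cont _ (cUphi ms)) w1).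
    by move=> k; exact: cont _ (cw k).
  have l2 : pair_sub (fun x => U_ (e k) x m0 - (phi x - psi (e k) x)) m0 nu
      @[k --> \oo] --> pair_sub (fun x => U x m0 - phi x) m0 nu.
    apply: (@pair_sub_ucvg _ _ (fun=> m0)).
    - by move=> h _; exact: cvg_cst.
    - by move=> k; apply: cont; exact: tC2_sub (tU_ _ _) (cphipsi _).
    - exact: cont (cUphi m0).
    - have [p1 _ _] := phi_c2e; refine (ucvgB _ p1).
      move=> x0 /U_near; apply: filterS => k + x => /(_ m0) /(le_lt_trans (c2norm_ub _ x).1).
      by rewrite lte_fin.
  apply: (ler_cvg_to l1 l2); apply: nearW => k.
  (* [strict_min] says nothing about a measure equal to the minimum point; the two values then
     coincide, by independence of the representation. *)
  have [sm|nsm] := pselect (same_measure m0 (m (e k))); last exact/ltW/minm.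
  rewrite /pair_sub (Rintegral_same _ sm).
  rewrite (_ : (fun x => U_ (e k) x m0 - _) =
    (fun x => U_ (e k) x (m (e k)) - (phi x - psi (e k) x)))//.
  apply/funext => x; congr (_ - _).
  by apply: continuousTP_same sm; case: (BU_ (e k)).
have W0 : W1_cvg (m \o e) m0.
  by move=> x0 /mW; apply: filterS => k; rewrite (W1_same _ same0).
have w0 : weak_cvg (m \o e) m0.
  by move=> h ch; rewrite -(Rintegral_same _ same0); exact: mw.
have [u1 u2 u3] := u_c2 m0 W0; have [w1 w2 w3] := w_c2 m0 W0.
have cu : tC2 u := tU m0.
have [cu1 cu2 _] := tC2_continuous cu.
have [_ cw2 _] := tC2_continuous (cUphi m0).
pose uk k := U_ (e k) ^~ (m (e k)).
have cgu i : continuous (fun x => tgrad u x 0 i) by rewrite tgrad_coord; exact: cu2.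
have gu i : ucvg (fun k x => tgrad (uk k) x 0 i) (fun x => tgrad u x 0 i).
  by rewrite tgrad_coord; under eq_fun do rewrite tgrad_coord; exact: u2.
have cgw i : continuous (fun x => tgrad w x 0 i) by rewrite tgrad_coord; exact: cw2.
pose wk k x := uk k x - (phi x - psi (e k) x).
have gw i : ucvg (fun k x => tgrad (wk k) x 0 i) (fun x => tgrad w x 0 i).
  by rewrite tgrad_coord; under eq_fun do rewrite tgrad_coord; exact: w2.
have cguk k i : continuous (fun x => tgrad (uk k) x 0 i).
  by rewrite tgrad_coord; have [_ c _] := tC2_continuous (cUm k); exact: c.
have cgwk k i : continuous (fun x => tgrad (wk k) x 0 i).
  by rewrite tgrad_coord; have [_ c _] := tC2_continuous (cw k); exact: c.
have gradpE K (g : torus R d -> 'rV[R]_d) i :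
    (fun x => gradp K x (g x) 0 i) = (fun x => partial i (K x) (g x)).
  by apply/funext => x; rewrite mxE.
pose bk k x := gradp (H_ (e k)) x (tgrad (uk k) x).
have cb i : continuous (fun x => b x 0 i).
  rewrite gradpE. exact: (hlift_continuous (C1_gradp_continuous (i := i) hH) cgu).
have cbk k i : continuous (fun x => bk k x 0 i).
  by rewrite gradpE; exact: (hlift_continuous (C1_gradp_continuous (i := i) (hH_ _)) (cguk k)).
have gb i : ucvg (fun k x => bk k x 0 i) (fun x => b x 0 i).
  have Hi : loc_unif_cvg (fun k => hlift (fun x => partial i (H_ (e k) x)))
      (hlift (fun x => partial i (H x))) := loc_unif_subseq ke (C1_gradp_cvg i H_cvg).
  have G := hlift_ucvg Hi (C1_gradp_continuous hH) cgu gu.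
  rewrite gradpE (_ : (fun k x => bk k x 0 i) =
    (fun k x => partial i (H_ (e k) x) (tgrad (uk k) x))); first exact: G.
  by apply/funext => k; exact: gradpE.
have cHu : continuous (fun x => H x (tgrad u x)).
  exact: (hlift_continuous hH.1 cgu).
have cHuk k : continuous (fun x => H_ (e k) x (tgrad (uk k) x)).
  exact: (hlift_continuous (hH_ _).1 (cguk k)).
have gHu : ucvg (fun k x => H_ (e k) x (tgrad (uk k) x)) (fun x => H x (tgrad u x)).
  have He : loc_unif_cvg (fun k => hlift (H_ (e k))) (hlift H) := loc_unif_subseq ke H_cvg.1.
  exact: (hlift_ucvg He hH.1 cgu gu).
have clap := @tlaplacian_continuous R d.
(* In each of the five terms a uniformly convergent sequence of continuous functions is integrated
   against weakly convergent measures, and against the fixed nu where it occurs. *)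
have T1 : pair_sub (uk k) (m (e k)) nu @[k --> \oo] --> pair_sub u m0 nu.
  by refine (pair_sub_ucvg w0 _ cu1 u1) => k; exact: cont _ (cUm k).
have T2 : pair_sub (fun x => - sigma * tlaplacian (uk k) x + H_ (e k) x (tgrad (uk k) x))
    (m (e k)) nu @[k --> \oo] -->
    pair_sub (fun x => - sigma * tlaplacian u x + H x (tgrad u x)) m0 nu.
  apply: (pair_sub_ucvg w0).
  - by move=> k; exact: (affine_continuous (clap _ (cUm k)) (cHuk k)).
  - exact: (affine_continuous (clap _ cu) cHu).
  - apply: ucvgD gHu; apply: ucvgZ; first exact: clap _ cu.
    exact: (tlaplacian_ucvg (u_c2 m0 W0)).
have T3 : pair_sub (f_ (e k) ^~ (m (e k))) (m (e k)) nu @[k --> \oo] -->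
    pair_sub (f^~ m0) m0 nu.
  apply: (pair_sub_ucvg w0).
  - by move=> k; exact: continuousTP_continuous.
  - exact: continuousTP_continuous.
  - apply: (continuousTP_ucvg (f_ := fun k => f_ (e k))) => // x mm.
    have [dl dl0 D] := f_cvg x mm; exists dl => // x0 x00.
    exact: near_subseq ke (D _ x00).
have T4 : pair_div (wk k) (bk k) (m (e k)) @[k --> \oo] --> pair_div w b m0.
  apply: cvgN; apply: (weak_ucvg w0).
  - by move=> k; exact: (dotv_continuous (cgwk k) (cbk k)).
  - exact: (dotv_continuous cgw cb).
  - exact: (dotv_ucvg cgw cb gw gb).
have T5 : pair_laplacian (wk k) (m (e k)) @[k --> \oo] --> pair_laplacian w m0.
  apply: (weak_ucvg w0).
  - by move=> k; exact: clap _ (cw k).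
  - exact: clap _ (cUphi m0).
  - exact: (tlaplacian_ucvg (w_c2 m0 W0)).
have lhs : pair_sub (f_ (e k) ^~ (m (e k))) (m (e k)) nu - pair_div (wk k) (bk k) (m (e k))
    - sigma * pair_laplacian (wk k) (m (e k)) @[k --> \oo] -->
    pair_sub (f^~ m0) m0 nu - pair_div w b m0 - sigma * pair_laplacian w m0.
  by apply: cvgB; [exact: cvgB|apply: cvgM; [exact: cvg_cst|exact: T5]].
have rhs : r * pair_sub (uk k) (m (e k)) nu +
    pair_sub (fun x => - sigma * tlaplacian (uk k) x + H_ (e k) x (tgrad (uk k) x)) (m (e k)) nu
    @[k --> \oo] --> r * pair_sub u m0 nu +
    pair_sub (fun x => - sigma * tlaplacian u x + H x (tgrad u x)) m0 nu.
  by apply: cvgD => //; apply: cvgM; [exact: cvg_cst|exact: T1].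
apply: (ler_cvg_to lhs rhs); apply: nearW => k.
exact: (U_sol (e k)).2 (cphipsi (e k)) (minm (e k)).
Qed.
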